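(* Let $X$ be a one-dimensional Lévy process with characteristic triplet $(A,\nu,\gamma)$ such that $A=0$, $\int_{|x|\le1}|x|\,\nu(dx)<\infty$, $\gamma_0:=\gamma-\int_{\mathbb R}h(x)\,\nu(dx)\ne0$, and $\int_{|x|\le1}|x|^\beta\,\nu(dx)<\infty$ for some $\beta\in(0,1)$. Let $S$ be a continuous increasing process (time change) with $S_0=0$, let $Y_t=X_{S_t}$, and for $\varepsilon>0$ let $T^\varepsilon_0=0$ and $T^\varepsilon_{i+1}=\inf\{t>T^\varepsilon_i:|Y_t-Y_{T^\varepsilon_i}|\ge\varepsilon\}$ for $i\ge0$. Let $f$ be a real bounded Lipschitz function on $\mathbb R$, and set $$V^\varepsilon(f)_t=\sum_{i\ge1:\,T^\varepsilon_i\le t}f\big(\varepsilon^{-1}(Y_{T^\varepsilon_i}-Y_{T^\varepsilon_{i-1}})\big),\qquad m(f)=\frac{E[f(X^*_{\tau^*_1})]}{E[\tau^*_1]},$$ where $X^*_t=\gamma_0t$ and $\tau^*_1:=\inf\{t\ge0:|X^*_t|\ge1\}$. Then, for every $\delta>0$, $$\varepsilon^{\max\{-(1-\beta-\delta),\,-\frac12\}}\,\big\{\varepsilon V^\varepsilon(f)_t-m(f)S_t\big\}\to0$$ as $\varepsilon\to0$, in probability uniformly in $t$ on compacts.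
   Context: Characteristic triplet convention: $X$ has characteristic triplet $(A,\nu,\gamma)$ with respect to the truncation function $h(x)=-1\vee x\wedge 1:=\max(-1,\min(x,1))$ if $E[e^{iuX_t}]=e^{t\psi(u)}$ with $\psi(u)=-\frac{Au^2}{2}+i\gamma u+\int_{\mathbb R}(e^{iux}-1-iuh(x))\,\nu(dx)$. The deterministic process $X^*_t=\gamma_0t$ is the limit in law of $(\varepsilon^{-1}X_{\varepsilon t})_{t\ge0}$ as $\varepsilon\downarrow0$ (scaling parameter $\alpha=1$). Convergence in probability uniformly in $t$ on compacts of $Z^\varepsilon$ to $Z$ means: for every $T>0$ and $\eta>0$, $P[\sup_{t\le T}|Z^\varepsilon_t-Z_t|>\eta]\to0$ as $\varepsilon\to0$. *)

(* Defs.v *)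
(* Processes are functions R -> T -> R of which only the times t >= 0 matter. *)
From HB Require Import structures.
From mathcomp Require Import all_boot all_order all_algebra.
From mathcomp Require Import complex.
From mathcomp Require Import all_classical all_reals all_analysis.

Set Implicit Arguments.
Unset Strict Implicit.
Unset Printing Implicit Defensive.
Import Order.TTheory GRing.Theory Num.Theory.
Import numFieldNormedType.Exports.
Local Open Scope classical_set_scope.
Local Open Scope ring_scope.

Section ComplexValued.
Context {R : realType}.
Local Open Scope complex_scope.

Definition cexp (z : R[i]) : R[i] :=
  (expR (complex.Re z))%:C * (cos (complex.Im z) +i* sin (complex.Im z)).

Definition Cintegral d (T : measurableType d) (mu : {measure set T -> \bar R})
    (f : T -> R[i]) : R[i] :=
  (\int[mu]_x complex.Re (f x))%R +i* (\int[mu]_x complex.Im (f x))%R.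

Definition truncation (x : R) : R := Num.max (-1) (Num.min x 1).

Definition levy_exponent (A : R) (nu : {measure set R -> \bar R}) (gamma : R)
    (u : R) : R[i] :=
  - (A * u ^+ 2 / 2)%:C + 'i%C * (gamma * u)%:C
  + Cintegral nu (fun x =>
      cexp ('i%C * (u * x)%:C) - 1 - 'i%C * (u * truncation x)%:C).

Definition char_function d (T : measurableType d) (P : probability T R)
    (Z : T -> R) (u : R) : R[i] :=
  Cintegral P (fun w => cexp ('i%C * (u * Z w)%:C)).

Definition levy_measure (nu : {measure set R -> \bar R}) : Prop :=
  nu [set 0] = 0%E /\
  (\int[nu]_x (Num.min 1 (x ^+ 2))%:E < +oo)%E.

Definition characteristic_triplet d (T : measurableType d)
    (P : probability T R) (X : R -> T -> R)
    (A : R) (nu : {measure set R -> \bar R}) (gamma : R) : Prop :=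
  [/\ 0 <= A, levy_measure nu &
      forall t u : R, 0 <= t ->
        char_function P (X t) u = cexp (t%:C * levy_exponent A nu gamma u)].

End ComplexValued.

Section Processes.
Context {R : realType} d {T : measurableType d}.
Implicit Types (P : probability T R) (X S : R -> T -> R).

Definition cadlag (x : R -> R) : Prop :=
  (forall t, 0 <= t -> x s @[s --> t^'+] --> x t) /\
  (forall t, 0 < t -> cvg (x s @[s --> t^'-])).

Definition mutually_independent P n (Z : 'I_n -> T -> R) : Prop :=
  forall B : 'I_n -> set R, (forall i, measurable (B i)) ->
    P [set w | forall i, B i (Z i w)] =
    (\prod_(i < n) P (Z i @^-1` B i))%E.

(* Continuity in probability is not listed: it follows from stationarity and
   right-continuity at 0. *)
Record levy_process P X : Prop := {
  levy_measurable : forall t, 0 <= t -> measurable_fun setT (X t) ;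
  levy_start : {ae P, forall w, X 0 w = 0} ;
  levy_independent : forall n (t : nat -> R), 0 <= t 0%N ->
    (forall i, t i <= t i.+1) ->
    mutually_independent P
      (fun (i : 'I_n) (w : T) => X (t i.+1) w - X (t i) w) ;
  levy_stationary : forall s h, 0 <= s -> 0 <= h ->
    forall B : set R, measurable B ->
      P [set w | B (X (s + h) w - X s w)] = P [set w | B (X h w)] ;
  levy_cadlag : {ae P, forall w, cadlag (X ^~ w)}
}.

Record time_change P S : Prop := {
  time_change_measurable : forall t, 0 <= t -> measurable_fun setT (S t) ;
  time_change_start : {ae P, forall w, S 0 w = 0} ;
  time_change_continuous :
    {ae P, forall w, {within `[0, +oo[, continuous (S ^~ w)}} ;
  time_change_increasing :
    {ae P, forall w, forall s t : R, 0 <= s -> s <= t -> S s w <= S t w}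
}.

(* The event that the supremum exceeds eta need not be measurable in general
   (the space is not assumed complete), so its probability is read as the outer
   probability mu_ext P, which is P on measurable sets. *)
Definition ucp_cvg P (Z : R -> R -> T -> R) (Z0 : R -> T -> R) : Prop :=
  forall a eta : R, 0 < a -> 0 < eta ->
    mu_ext P [set w | (eta%:E <
        ereal_sup [set `|Z eps t w - Z0 t w|%:E | t in `[0%R, a]])%E]
      @[eps --> 0^'+] --> 0%E.

End Processes.

Section HittingTimes.
Context {R : realType}.
Implicit Types (y : R -> R) (eps t : R).

(* Extended-real valued: a time that never occurs is ereal_inf set0 = +oo,
   and so are then all the later ones. *)
Fixpoint hit_time eps y (i : nat) : \bar R :=
  if i is j.+1 then
    ereal_inf [set t%:E | t in [set t : R | (hit_time eps y j < t%:E)%E /\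
                          eps <= `|y t - y (fine (hit_time eps y j))|]]
  else 0%E.

(* For a cadlag path y, finitely many hitting times are <= t, so that this
   finitely supported sum is the intended one. *)
Definition V_path eps (f : R -> R) y t : R :=
  \sum_(i \in [set i : nat | (0 < i)%N /\ (hit_time eps y i <= t%:E)%E])
    f (eps^-1 * (y (fine (hit_time eps y i)) -
                 y (fine (hit_time eps y i.-1)))).

Definition unit_exit_time y : R := inf [set t | 0 <= t /\ 1 <= `|y t|].

End HittingTimes.

Section LimitConstant.
Context {R : realType} d {T : measurableType d}.

Definition time_changed (X S : R -> T -> R) : R -> T -> R :=
  fun t w => X (S t w) w.

Definition Vproc (eps : R) (f : R -> R) (Y : R -> T -> R) : R -> T -> R :=
  fun t w => V_path eps f (Y ^~ w) t.

Definition drift0 (nu : {measure set R -> \bar R}) (gamma : R) : R :=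
  gamma - \int[nu]_x truncation x.

Definition Xstar (gamma0 : R) : R -> T -> R := fun t _ => gamma0 * t.

Definition mean_limit (P : probability T R) (Z : R -> T -> R) (f : R -> R) : R :=
  let tau w := unit_exit_time (Z ^~ w) in
  fine 'E_P[fun w => f (Z (tau w) w)] / fine 'E_P[tau].

End LimitConstant.

(* Main.v *)
Require Import Defs.
From HB Require Import structures.
From mathcomp Require Import all_boot all_order all_algebra.
From mathcomp Require Import complex ring lra zify.
From mathcomp Require Import all_classical all_reals all_analysis measurable_realfun.

Set Implicit Arguments.
Unset Strict Implicit.
Unset Printing Implicit Defensive.
Import Order.TTheory GRing.Theory Num.Theory.
Import numFieldNormedType.Exports.
Local Open Scope classical_set_scope.
Local Open Scope ring_scope.

(** Write c for [drift0 nu gamma] and z_s = X_s - c s.  The process z carries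
    only the jumps of X, and these are beta-summable; the proof measures z by
    its variation for the subadditive gauge y |-> min(|y|, e), where e is the
    size of the exit intervals, and splits into a pathwise and a
    probabilistic half.

    Pathwise half.  Let w be the increase of that variation between two
    consecutive hitting times.  If w < e/4, then z moves by at most w in the
    meantime, so that X runs along its drift: on the clock of X the interval
    lasts e/|c| up to w/|c|, and X leaves it at distance e in the direction of
    the drift, up to 2w ([calm_exit]).  If w >= e/4, then e <= 4w and the
    contribution of the interval is O(w) for trivial reasons, provided that
    the interval does not last long; it cannot, because whenever the drift
    covers 3e while X oscillates by at most 2e, the process z has to compensate
    it by a move of size e at least ([drift_chop]).  Summing over the
    intervals, the error e V_t - f(sgn c)|c| S_t is O(W + e), uniformly in t,
    where W bounds the total variation of z up to the time S_t
    ([time_changed_error]); and f(sgn c)|c| is the constant m(f)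
    ([mean_limitE]).  The continuous time change only relabels the exit times,
    by the intermediate value theorem.

    Probabilistic half.  The jumps of z need not be constructed: the variation
    of z is the supremum of its sums over dyadic grids, and their expectation
    only involves the law of z_h for small h.  The characteristic function
    gives 1 - E cos(u z_h) <= C h (1 + |u|^beta) ([expectation_cos_bound]).
    Averaging over u in [0, 1] turns this into the tail estimate
    P(|z_h| >= 2a) <= C h a^-beta ([increment_tail]), and summing over the
    levels a = e/4, e/8, ... into E min(|z_h|, e) <= C h e^(1 - beta)
    ([capped_expectation]).  Hence the variation of z up to a fixed time has
    expectation O(e^(1 - beta)), and Markov's inequality beats the
    normalisation e^rho of the theorem, since rho >= -(1 - beta - delta). *)

(** * The capped distance *)

Section Capped.
Context {R : realType}.
Implicit Types (e x y : R).

Definition capped e x : R := Num.min `|x| e.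

Lemma capped_ge0 e x : 0 <= e -> 0 <= capped e x.
Proof. by move=> e0; rewrite /capped le_min normr_ge0. Qed.

Lemma capped_le e x : capped e x <= e.
Proof. by rewrite /capped ge_min lexx orbT. Qed.

Lemma cappedD e x y : 0 <= e -> capped e (x + y) <= capped e x + capped e y.
Proof.
move=> e0; rewrite /capped; have xy := ler_normD x y.
have := normr_ge0 x; have := normr_ge0 y.
by rewrite !minEle; do 3 case: ifPn; rewrite -?ltNge => *; lra.
Qed.

Lemma capped_gt e x y : capped e x <= y -> y < e -> `|x| <= y.
Proof. by rewrite /capped ge_min => /orP[//|ey ye]; lra. Qed.

Lemma cvg_capped (T : Type) (F : set_system T) e (u : T -> R) (l : R) :
  Filter F -> u x @[x --> F] --> l -> capped e (u x) @[x --> F] --> capped e l.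
Proof.
move=> FF ul.
have cc : {for l, continuous (capped e)}.
  apply: continuous_min; last exact: cvg_cst.
  exact: norm_continuous.
exact: (cvg_comp _ _ ul cc).
Qed.

Lemma capped_telescope e (u : nat -> R) m n : 0 <= e -> (m <= n)%N ->
  capped e (u n - u m) <= \sum_(m <= k < n) capped e (u k.+1 - u k).
Proof.
move=> e0; elim: n => [|n IHn].
  by rewrite leqn0 => /eqP ->; rewrite subrr big_geq// /capped normr0 ge_min lexx.
rewrite leq_eqVlt => /orP[/eqP ->|]; first by rewrite subrr big_geq// /capped normr0 ge_min lexx.
rewrite ltnS => mn; rewrite big_nat_recr//= (_ : _ - u m = (u n - u m) + (u n.+1 - u n)).
  by apply: le_trans (cappedD _ _ e0) _; rewrite lerD2r IHn.
by ring.
Qed.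

End Capped.

(** * Variation controls from dyadic sums *)

Section Control.
Context {R : realType}.
Variables (e : R) (z : R -> R).

Definition dyadic (m k : nat) : R := k%:R / (2 ^ m)%:R.

Definition dyadic_variation (n m : nat) : R :=
  \sum_(0 <= k < n * 2 ^ m) capped e (z (dyadic m k.+1) - z (dyadic m k)).

(** Sums of capped increments of [z] along chains 0 = s_0 <= ... <= s_k = s.
    Ending the chain exactly at [s] makes the supremum over all chains
    superadditive without having to glue partitions. *)
Inductive chain_sum : R -> R -> Prop :=
| chain_sum0 : chain_sum 0 0
| chain_sumS r s a : chain_sum r a -> r <= s ->
    chain_sum s (a + capped e (z s - z r)).

(** Refining a grid increases the sum, the gauge being subadditive; this is
    what allows one bound on the probability for all grids at once. *)
Lemma dyadic_variation_nondecreasing n : 0 <= e ->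
  nondecreasing_seq (dyadic_variation n).
Proof.
move=> e0; apply/nondecreasing_seqP => m; rewrite /dyadic_variation.
have -> : (n * 2 ^ m.+1)%N = (n * 2 ^ m).*2 by rewrite expnS -muln2; lia.
elim: (n * 2 ^ m)%N => [|k IHk]; first by rewrite !big_geq.
rewrite doubleS !big_nat_recr//= -addrA; apply: lerD => //.
have dy j : dyadic m j = dyadic m.+1 j.*2.
  rewrite /dyadic expnS -mul2n !natrM; field.
  by rewrite pnatr_eq0 expn_eq0.
rewrite !dy doubleS.
apply: (le_trans _ (cappedD _ _ e0)).
by rewrite le_eqVlt; apply/orP; left; apply/eqP; congr capped; ring.
Qed.

Definition dyadic_next (m : nat) (s : R) : nat := (Num.truncn (s * (2 ^ m)%:R)).+1.

Lemma pow2_gt0 m : 0 < (2 ^ m)%:R :> R.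
Proof. by rewrite ltr0n expn_gt0. Qed.

(** Times are rounded up strictly, because right limits exclude the point. *)
Lemma dyadic_next_itv m s : 0 <= s ->
  s < dyadic m (dyadic_next m s) <= s + (2 ^ m)%:R^-1.
Proof.
move=> s0; have p0 := pow2_gt0 m; have := @truncn_itv R (s * (2 ^ m)%:R) (mulr_ge0 s0 (ltW p0)).
rewrite /dyadic/dyadic_next => /andP[a b]; rewrite ltr_pdivlMr// b/=.
by rewrite ler_pdivrMr// mulrDl mulVf ?gt_eqF// -natr1 lerD2r.
Qed.

Lemma dyadic_next_le m r s : r <= s -> (dyadic_next m r <= dyadic_next m s)%N.
Proof. by move=> rs; rewrite ltnS le_truncn// ler_wpM2r// ltW// pow2_gt0. Qed.

Lemma dyadic_next_bound m (n : nat) s : 0 <= s -> s < n%:R ->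
  (dyadic_next m s <= n * 2 ^ m)%N.
Proof.
move=> s0 sn; have p0 := pow2_gt0 m; rewrite truncn_lt_nat; last by rewrite mulr_ge0// ltW.
by rewrite natrM ltr_pM2r.
Qed.

Hypothesis e0 : 0 <= e.
Hypothesis z_right : forall s, 0 <= s -> z x @[x --> s^'+] --> z s.

Lemma cvg_dyadic_next s : 0 <= s ->
  z (dyadic m (dyadic_next m s)) @[m --> \oo] --> z s.
Proof.
move=> s0; have /cvg_at_rightP := z_right s0; apply; split.
  by move=> m; case/andP: (dyadic_next_itv m s0).
have c2 : s + (2 ^ m)%:R^-1 @[m --> \oo] --> s.
  rewrite -[X in _ --> X]addr0; apply: cvgD; first exact: cvg_cst.
  have -> : (fun m => (2 ^ m)%:R^-1) = geometric (1 : R) 2^-1.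
    by apply/funext => m; rewrite /geometric/= mul1r natrX exprVn.
  by apply: cvg_geometric; rewrite ger0_norm ?invr_ge0// invf_lt1// ltr1n.
have c1 : (fun=> s) m @[m --> \oo] --> s by exact: cvg_cst.
apply: squeeze_cvgr c1 c2; near=> m => /=.
by have /andP[/ltW -> ->] := dyadic_next_itv m s0.
Unshelve. all: by end_near. Qed.

Lemma chain_sum_ge0 s a : chain_sum s a -> 0 <= s.
Proof. by elim=> // r t b _ r0 rt; exact: le_trans rt. Qed.

(** Rounding the points of a chain up to the grids yields sums that a dyadic
    sum dominates, and that converge to the original one by right
    continuity. *)
Lemma chain_sum_dyadic s a : chain_sum s a ->
  exists2 u : nat -> R, u m @[m --> \oo] --> a &
    forall m, u m <= \sum_(0 <= k < dyadic_next m s)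
                       capped e (z (dyadic m k.+1) - z (dyadic m k)).
Proof.
elim=> [|r t b rb [u ub ule] rt].
  exists (fun=> 0); first exact: cvg_cst.
  by move=> m; apply: sumr_ge0 => k _; exact: capped_ge0.
have r0 := chain_sum_ge0 rb; have t0 := le_trans r0 rt.
exists (fun m => u m + capped e (z (dyadic m (dyadic_next m t)) - z (dyadic m (dyadic_next m r)))).
  apply: cvgD => //; apply: cvg_capped; apply: cvgB; exact: cvg_dyadic_next.
move=> m; rewrite (big_cat_nat (n := dyadic_next m r))//=; last exact: dyadic_next_le.
apply: lerD => //; exact: (capped_telescope (z \o dyadic m) e0 (dyadic_next_le m rt)).
Qed.

Variables (n : nat) (W : R).
Hypothesis varW : forall m, dyadic_variation n m <= W.

Lemma chain_sum_le s a : s < n%:R -> chain_sum s a -> a <= W.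
Proof.
move=> sn sa; have s0 := chain_sum_ge0 sa.
have [u ua ule] := chain_sum_dyadic sa.
rewrite -(cvg_lim _ ua)//; apply: limr_le => //; first by apply/cvg_ex; exists a.
near=> m; apply: le_trans (ule m) (le_trans _ (varW m)).
rewrite /dyadic_variation [leRHS](big_cat_nat (n := dyadic_next m s))//=; last first.
  exact: dyadic_next_bound.
by rewrite lerDl sumr_ge0// => k _; exact: capped_ge0.
Unshelve. all: by end_near. Qed.

(** The supremum of the chain sums dominates every capped increment of [z] by
    a difference of values of one function, so that later estimates telescope. *)
Lemma variation_control : exists2 F : R -> R,
  forall s : R, 0 <= s < n%:R -> 0 <= F s <= W &
  forall p q : R, 0 <= p -> p <= q -> q < n%:R -> capped e (z q - z p) <= F q - F p.
Proof.
have ex s : 0 <= s -> chain_sum s (0 + capped e (z s - z 0)).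
  by move=> s0; exact: (chain_sumS chain_sum0 s0).
pose F s := sup [set a | chain_sum s a].
have ubd s : s < n%:R -> ubound [set a | chain_sum s a] W.
  by move=> sn a /= sa; exact: chain_sum_le sa.
exists F => [s /andP[s0 sn]|p q p0 pq qn].
  apply/andP; split.
    apply: le_trans (ub_le_sup _ (ex _ s0)); last by exists W; exact: ubd.
    by rewrite add0r capped_ge0.
  by apply: ge_sup; [eexists; exact: ex | exact: ubd].
rewrite lerBrDr addrC -lerBrDr; apply: ge_sup; first by eexists; exact: ex.
move=> a /= pa; rewrite lerBrDr; apply: ub_le_sup; first by exists W; exact: ubd.
exact: (chain_sumS pa pq).
Qed.

End Control.

(** * One exit interval *)

Section ExitIntervals.
Context {R : realType}.
Implicit Types (c e K L a b p q : R) (x z F : R -> R).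

Definition controls K e z F : Prop := forall p q, 0 <= p -> p <= q -> q < K ->
  capped e (z q - z p) <= F q - F p.

(** [z] is the path without its drift. *)
Definition drifted c z p : R := c * p + z p.

Definition stays_within e x a b : Prop :=
  forall p, a <= p -> p < b -> `|x p - x a| < e.

Lemma control_nondecreasing K e z F p q : 0 <= e -> controls K e z F ->
  0 <= p -> p <= q -> q < K -> F p <= F q.
Proof.
by move=> e0 Fz p0 pq qK; rewrite -subr_ge0 (le_trans _ (Fz _ _ p0 pq qK))// capped_ge0.
Qed.

Lemma drift_le c z p q (x := drifted c z) : p <= q ->
  `|c| * (q - p) <= `|x q - x p| + `|z q - z p|.
Proof.
move=> pq; rewrite -[X in _ * X]ger0_norm ?subr_ge0// -normrM.
rewrite (_ : c * (q - p) = (x q - x p) - (z q - z p)) ?ler_normB//.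
by rewrite /x /drifted; ring.
Qed.

(** Each time the drift covers 3e while the path oscillates by at most 2e,
    [z] has to move by e or more, which costs e of variation. *)
Lemma drift_chop c e K z F a b (x := drifted c z) : c != 0 -> 0 < e ->
  controls K e z F -> 0 <= a -> a <= b -> b < K ->
  (forall p q, a <= p -> p <= q -> q <= b -> `|x q - x p| <= 2 * e) ->
  `|c| * (b - a) <= 3 * e + 3 * (F b - F a).
Proof.
move=> c0 e0 Fz a0 ab bK osc; pose l := 3 * e / `|c|.
have l0 : 0 < l by rewrite divr_gt0 ?normr_gt0// mulr_gt0.
have c_gt0 : 0 < `|c| by rewrite normr_gt0.
have cl : `|c| * l = 3 * e by rewrite /l mulrC divfK// gt_eqF.
have step (k : nat) : a + k%:R * l <= b -> k%:R * e <= F (a + k%:R * l) - F a.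
  elim: k => [|k IHk]; first by rewrite !mul0r addr0 subrr.
  rewrite -natr1 => kb; have k0 : 0 <= k%:R :> R by [].
  have kl0 : 0 <= k%:R * l by rewrite mulr_ge0// ltW.
  have {}IHk : k%:R * e <= F (a + k%:R * l) - F a by apply: IHk; lra.
  set p := a + k%:R * l in IHk *; set q := a + (k%:R + 1) * l in kb *.
  have qp : q - p = l by rewrite /p /q; ring.
  have pq : p <= q by lra.
  have ap : a <= p by rewrite /p; lra.
  have := drift_le c z pq; rewrite qp cl => zpq.
  have xpq := osc _ _ ap pq kb.
  (* [z] moves by e at least, so the cap is attained. *)
  have := Fz _ _ (le_trans a0 ap) pq (le_lt_trans kb bK).
  rewrite /capped minEle; case: ifPn => _ ?; rewrite -/x in zpq; lra.
have [n0 n1] : (Num.truncn ((b - a) / l))%:R <= (b - a) / l /\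
    (b - a) / l < (Num.truncn ((b - a) / l))%:R + 1.
  by apply/andP; rewrite natr1 truncn_itv// divr_ge0 ?subr_ge0// ltW.
set n := Num.truncn _ in n0 n1.
rewrite ler_pdivlMr// in n0; rewrite ltr_pdivrMr// in n1.
have nb : a + n%:R * l <= b by lra.
have := step n nb; have nl0 : 0 <= n%:R * l by rewrite mulr_ge0// ltW.
have anl : 0 <= a + n%:R * l by lra.
have Fnb := control_nondecreasing (ltW e0) Fz anl nb bK.
have : `|c| * (b - a) <= (n%:R + 1) * (`|c| * l).
  by rewrite mulrCA ler_pM2l// ltW.
by rewrite cl; lra.
Qed.

Lemma ler_left_limit c a b L : c != 0 -> a <= b -> 0 <= L ->
  (forall p, a <= p -> p < b -> `|c| * (p - a) <= L) -> `|c| * (b - a) <= L.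
Proof.
move=> c0 ab L0 H; have c_gt0 : 0 < `|c| by rewrite normr_gt0.
rewrite leNgt; apply/negP => Lab.
have {}Lab : L / `|c| < b - a by rewrite ltr_pdivrMr// mulrC.
pose p := a + (L / `|c| + (b - a)) / 2.
have Lc : 0 <= L / `|c| by rewrite divr_ge0// ltW.
have : `|c| * (p - a) <= L by apply: H; rewrite /p; lra.
rewrite mulrC -ler_pdivlMr// /p; lra.
Qed.

Lemma inside_osc e x a b p q : stays_within e x a b ->
  a <= p -> p < b -> a <= q -> q < b -> `|x q - x p| <= 2 * e.
Proof.
move=> inside ap pb aq qb; have := inside _ ap pb; have := inside _ aq qb => xq xp.
have := ler_normB (x q - x a) (x p - x a).
rewrite (_ : x q - x a - (x p - x a) = x q - x p); [lra|ring].
Qed.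

Lemma open_interval_drift c e K z F a b (x := drifted c z) : c != 0 -> 0 < e ->
  controls K e z F -> 0 <= a -> a <= b -> b < K -> stays_within e x a b ->
  `|c| * (b - a) <= 3 * e + 3 * (F b - F a).
Proof.
move=> c0 e0 Fz a0 ab bK inside.
have Fab := control_nondecreasing (ltW e0) Fz a0 ab bK.
apply: ler_left_limit => //; first lra.
move=> p ap pb; have p0 := le_trans a0 ap; have pK := lt_trans pb bK.
have Fpb := control_nondecreasing (ltW e0) Fz p0 (ltW pb) bK.
apply: le_trans (drift_chop c0 e0 Fz a0 ap pK _) _; last lra.
move=> r s ar rs sp; have sb := le_lt_trans sp pb.
exact: (inside_osc inside ar (le_lt_trans rs sb) (le_trans ar rs) sb).
Qed.

(** A variation below e/4 never reaches the cap, so it bounds the moves of [z]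
    themselves; up to them the path is its drift, and it has to cover e to
    exit.  The jump that may end the interval is included, since [b] is. *)
Lemma calm_exit c e K z F a b (x := drifted c z) : c != 0 -> 0 < e ->
  controls K e z F -> 0 <= a -> a <= b -> b < K -> stays_within e x a b ->
  e <= `|x b - x a| ->
  4 * (F b - F a) < e ->
  `|z b - z a| <= F b - F a /\ `| `|c| * (b - a) - e | <= F b - F a.
Proof.
move=> c0 e0 Fz a0 ab bK inside exit we; have Fab := control_nondecreasing (ltW e0) Fz a0 ab bK.
have small p : a <= p -> p <= b -> `|z p - z a| <= F b - F a.
  move=> ap pb; apply: (@capped_gt _ e); last lra.
  apply: le_trans (Fz _ _ a0 ap (le_lt_trans pb bK)) _.
  by rewrite lerD2r (control_nondecreasing (ltW e0) Fz)// (le_trans a0).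
have up : `|c| * (b - a) <= e + (F b - F a).
  apply: ler_left_limit => //; first lra.
  move=> p ap pb; apply: le_trans (drift_le c z ap) _.
  by have := inside _ ap pb; rewrite -/x; have := small p ap (ltW pb); lra.
have lo : `|x b - x a| <= `|c| * (b - a) + `|z b - z a|.
  rewrite -[X in _ * X + _]ger0_norm ?subr_ge0// -normrM.
  by rewrite (_ : x b - x a = c * (b - a) + (z b - z a)) ?ler_normD// /x /drifted; ring.
have zb := small b ab (lexx b); split => //.
by rewrite ler_norml; apply/andP; split; lra.
Qed.

Lemma exit_duration c e K z F a b (x := drifted c z) : c != 0 -> 0 < e ->
  controls K e z F -> 0 <= a -> a <= b -> b < K -> stays_within e x a b ->
  e <= `|x b - x a| ->
  `| `|c| * (b - a) - e | <= 15 * (F b - F a).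
Proof.
move=> c0 e0 Fz a0 ab bK inside exit.
have Fab := control_nondecreasing (ltW e0) Fz a0 ab bK.
have cab := open_interval_drift c0 e0 Fz a0 ab bK inside.
have cba0 : 0 <= `|c| * (b - a) by rewrite mulr_ge0 ?subr_ge0.
have [we|/(calm_exit c0 e0 Fz a0 ab bK inside exit)[_ cb]] := lerP e (4 * (F b - F a)); last lra.
by rewrite ler_norml; apply/andP; split; lra.
Qed.

(** In the calm case, leaving against the drift or overshooting e would need
    a move of [z], and [calm_exit] limits those to the variation. *)
Lemma exit_position c e K z F a b (x := drifted c z) : c != 0 -> 0 < e ->
  controls K e z F -> 0 <= a -> a <= b -> b < K -> stays_within e x a b ->
  e <= `|x b - x a| ->
  e <= 4 * (F b - F a) \/
  `|(x b - x a) / e - Num.sg c| <= 2 * (F b - F a) / e.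
Proof.
move=> c0 e0 Fz a0 ab bK inside exit.
have [we|/(calm_exit c0 e0 Fz a0 ab bK inside exit)[zb cb]] :=
  lerP e (4 * (F b - F a)); [by left|right].
have -> : (x b - x a) / e - Num.sg c = (Num.sg c * (`|c| * (b - a) - e) + (z b - z a)) / e.
  by rewrite mulrBr mulrA -numEsg /x /drifted; field; exact: lt0r_neq0.
rewrite normrM [X in _ * X]ger0_norm ?invr_ge0 ?(ltW e0)// ler_pM2r ?invr_gt0//.
apply: le_trans (ler_normD _ _) _; rewrite normrM normr_sg c0 mul1r; lra.
Qed.

(** When e <= 4 (F b - F a), the boundedness of [f] is enough; otherwise its
    Lipschitz constant is applied to the overshoot. *)
Lemma exit_value_bound c e K z F (f : R -> R) (M : R) L a b (x := drifted c z) : c != 0 -> 0 < e ->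
  controls K e z F -> 0 <= a -> a <= b -> b < K -> stays_within e x a b ->
  e <= `|x b - x a| -> 0 <= L ->
  (forall y, `|f y| <= M) -> (forall y y', `|f y - f y'| <= L * `|y - y'|) ->
  `|e * f ((x b - x a) / e) - f (Num.sg c) * (`|c| * (b - a))| <=
    (2 * L + 23 * M) * (F b - F a).
Proof.
move=> c0 e0 Fz a0 ab bK ins ex L0 fM fL.
have w0 : 0 <= F b - F a by rewrite subr_ge0 (control_nondecreasing (ltW e0) Fz).
have M0 : 0 <= M := le_trans (normr_ge0 _) (fM 0).
set y := (x b - x a) / e; set s := Num.sg c; set w := F b - F a in w0 *.
have Mw : 0 <= M * w by rewrite mulr_ge0.
have Lw : 0 <= L * w by rewrite mulr_ge0.
have fys : e * `|f y - f s| <= 2 * (L * w) + 8 * (M * w).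
  have [ew|yw] := exit_position c0 e0 Fz a0 ab bK ins ex.
    have : e * `|f y - f s| <= 4 * w * (2 * M).
      apply: ler_pM => //; first exact: ltW.
      by apply: le_trans (ler_normB _ _) _; rewrite mulr2n mulrDl !mul1r lerD.
    lra.
  have : e * `|f y - f s| <= e * (L * (2 * w / e)).
    by rewrite ler_pM2l// (le_trans (fL _ _))// ler_wpM2l.
  rewrite (_ : e * (L * _) = 2 * (L * w)); first lra.
  by field; exact: lt0r_neq0.
have dur := exit_duration c0 e0 Fz a0 ab bK ins ex.
have fd : `|f s| * `| `|c| * (b - a) - e| <= M * (15 * w) by apply: ler_pM.
rewrite (_ : _ - _ = e * (f y - f s) - f s * (`|c| * (b - a) - e)); last by ring.
apply: le_trans (ler_normB _ _) _; rewrite !normrM (ger0_norm (ltW e0)); lra.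
Qed.

End ExitIntervals.

(** * Chains of exit intervals *)

Section ExitChains.
Context {R : realType}.
Implicit Types (c e K W L M t : R) (x z F f : R -> R) (a : nat -> R).

Definition exit_chain e x a (n : nat) : Prop :=
  a 0%N = 0 /\ forall i, (i < n)%N ->
    [/\ a i <= a i.+1, stays_within e x (a i) (a i.+1) &
        e <= `|x (a i.+1) - x (a i)|].

Lemma exit_chainW e x a n : exit_chain e x a n.+1 -> exit_chain e x a n.
Proof. by case=> a0 H; split=> // i iN; apply: H; rewrite ltnS ltnW. Qed.

Lemma exit_chain_ge0 e x a n : exit_chain e x a n -> 0 <= a n.
Proof.
elim: n => [[->]//|n IHn Hn]; have [_ /(_ n (ltnSn n))[le_a _ _]] := Hn.
by rewrite (le_trans _ le_a)// IHn//; exact: exit_chainW Hn.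
Qed.

(** Besides comparing the elapsed drift with the number of exits, this bounds
    the number of exits before a given time. *)
Lemma exit_chain_count c e K z F a n (x := drifted c z) : c != 0 -> 0 < e ->
  controls K e z F -> exit_chain e x a n -> a n < K ->
  `| `|c| * a n - e * n%:R| <= 15 * (F (a n) - F 0).
Proof.
move=> c0 e0 Fz; elim: n => [[-> _] _|n IHn Hn aK].
  by rewrite !mulr0 !subrr normr0 mulr0.
have [_ /(_ n (ltnSn n))[le_a ins ex]] := Hn.
have {}IHn := IHn (exit_chainW Hn) (le_lt_trans le_a aK).
have an0 := exit_chain_ge0 (exit_chainW Hn).
have dur := exit_duration c0 e0 Fz an0 le_a aK ins ex.
rewrite -natr1 (_ : _ - _ = (`|c| * (a n.+1 - a n) - e) + (`|c| * a n - e * n%:R)); last by ring.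
apply: le_trans (ler_normD _ _) _; lra.
Qed.

Lemma exit_chain_sum c e K z F f M L a n (x := drifted c z) : c != 0 -> 0 < e ->
  controls K e z F -> exit_chain e x a n -> a n < K -> 0 <= L ->
  (forall y, `|f y| <= M) -> (forall y y', `|f y - f y'| <= L * `|y - y'|) ->
  `|e * (\sum_(i < n) f ((x (a i.+1) - x (a i)) / e)) - f (Num.sg c) * (`|c| * a n)|
    <= (2 * L + 23 * M) * (F (a n) - F 0).
Proof.
move=> c0 e0 Fz + + L0 fM fL; elim: n => [[-> _] _|n IHn Hn aK].
  by rewrite big_ord0 !mulr0 !subrr normr0 mulr0.
have [_ /(_ n (ltnSn n))[le_a ins ex]] := Hn.
have {}IHn := IHn (exit_chainW Hn) (le_lt_trans le_a aK).
have an0 := exit_chain_ge0 (exit_chainW Hn).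
have val := exit_value_bound c0 e0 Fz an0 le_a aK ins ex L0 fM fL.
rewrite big_ord_recr/=; set S := \sum_(i < n) _ in IHn *; set y := f (_ / e) in val *.
rewrite (_ : _ - _ = (e * S - f (Num.sg c) * (`|c| * a n)) +
  (e * y - f (Num.sg c) * (`|c| * (a n.+1 - a n)))); last by ring.
rewrite [leRHS](_ : _ = (2 * L + 23 * M) * (F (a n) - F 0) +
  (2 * L + 23 * M) * (F (a n.+1) - F (a n))); last by ring.
by apply: le_trans (ler_normD _ _) _; apply: lerD.
Qed.

(** The term in [e] comes from the last, unfinished interval. *)
Lemma exit_chain_bound c e K W z F f M L a n t (x := drifted c z) : c != 0 -> 0 < e ->
  controls K e z F -> (forall s, 0 <= s < K -> 0 <= F s <= W) ->
  exit_chain e x a n -> a n <= t -> t < K -> stays_within e x (a n) t -> 0 <= L ->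
  (forall y, `|f y| <= M) -> (forall y y', `|f y - f y'| <= L * `|y - y'|) ->
  `|e * (\sum_(i < n) f ((x (a i.+1) - x (a i)) / e)) - f (Num.sg c) * `|c| * t|
    <= (2 * L + 26 * M) * W + 3 * M * e.
Proof.
move=> c0 e0 Fz FW Ha at_ tK ins L0 fM fL.
have an0 := exit_chain_ge0 Ha; have aK := le_lt_trans at_ tK.
have t0 := le_trans an0 at_.
have sum := exit_chain_sum c0 e0 Fz Ha aK L0 fM fL.
have dur := open_interval_drift c0 e0 Fz an0 at_ tK ins.
have ct0 : 0 <= `|c| * (t - a n) by rewrite mulr_ge0 ?subr_ge0.
have M0 : 0 <= M := le_trans (normr_ge0 _) (fM 0).
have /andP[F00 F0W] : 0 <= F 0 <= W by apply: FW; rewrite lexx (le_lt_trans t0).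
have /andP[Fa0 FaW] : 0 <= F (a n) <= W by apply: FW; rewrite an0.
have /andP[Ft0 FtW] : 0 <= F t <= W by apply: FW; rewrite t0.
have tail : `|f (Num.sg c)| * `| `|c| * (t - a n)| <= M * (3 * e + 3 * W).
  by apply: ler_pM => //; rewrite ger0_norm//; lra.
have main : (2 * L + 23 * M) * (F (a n) - F 0) <= (2 * L + 23 * M) * W.
  by apply: ler_wpM2l; lra.
rewrite (_ : _ - _ = (e * (\sum_(i < n) f ((x (a i.+1) - x (a i)) / e)) -
   f (Num.sg c) * (`|c| * a n)) -
   f (Num.sg c) * (`|c| * (t - a n))); last by ring.
apply: le_trans (ler_normB _ _) _; rewrite [X in _ + X]normrM; rewrite -/x in sum.
by move: sum; set S := `|_ - _| => sum; lra.
Qed.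

End ExitChains.

(** * Hitting times of the time-changed path *)

Section TimeChange.
Context {R : realType}.
Implicit Types (e t u v r eta K W L M : R) (x s y f : R -> R).

Lemma right_continuous_ball x t eta : x r @[r --> t^'+] --> x t -> 0 < eta ->
  exists2 d : R, 0 < d & forall r, t <= r -> r < t + d -> `|x r - x t| < eta.
Proof.
move=> /cvgrPdist_lt H eta0; have /nbhs_ballP[d /= d0 {}H] := H _ eta0.
exists d => // r; rewrite le_eqVlt => /predU1P[<- _|tr rd]; first by rewrite subrr normr0.
by rewrite distrC; apply: H => //=; rewrite /ball/= ltr_norml; apply/andP; split; lra.
Qed.

Lemma right_continuous_comp x s t eta :
  (forall r, 0 <= r -> x u @[u --> r^'+] --> x r) ->
  {within `[0, +oo[, continuous s} -> (forall u v, 0 <= u -> u <= v -> s u <= s v) ->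
  0 <= t -> 0 <= s t -> 0 < eta ->
  exists2 d : R, 0 < d & forall r, t <= r -> r < t + d -> `|x (s r) - x (s t)| < eta.
Proof.
move=> xr sc smon t0 st0 eta0.
have [d d0 xd] := right_continuous_ball (xr _ st0) eta0.
have /continuous_within_itvcyP[sin s0] := sc.
have st : s r @[r --> t^'+] --> s t.
  move: t0; rewrite le_eqVlt => /predU1P[<-//|t0].
  by apply: cvg_at_right_filter; apply: sin; rewrite in_itv/= t0.
have [h h0 sh] := right_continuous_ball st d0.
exists h => // r tr rh; apply: xd; first exact: smon.
by have := sh _ tr rh; rewrite ltr_norml => /andP[_]; lra.
Qed.

Lemma hit_time_nondecreasing e y : nondecreasing_seq (hit_time e y).
Proof.
apply/nondecreasing_seqP => n /=.
by apply: le_ereal_inf_tmp => _ /= [t [lt_t _] <-]; exact: ltW.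
Qed.

Definition right_continuous_from0 y : Prop := forall t eta, 0 <= t -> 0 < eta ->
  exists2 d : R, 0 < d & forall r, t <= r -> r < t + d -> `|y r - y t| < eta.

(** Right continuity makes the infimum that defines the next hitting time
    attained, so that the displacement at that time is at least [e]. *)
Lemma hit_timeS e y n a t : 0 < e -> right_continuous_from0 y -> 0 <= a ->
  hit_time e y n = a%:E -> (hit_time e y n.+1 <= t%:E)%E ->
  exists b, [/\ hit_time e y n.+1 = b%:E, a <= b, b <= t,
    e <= `|y b - y a| & stays_within e y a b].
Proof.
move=> e0 yr a0 na; rewrite [hit_time _ _ _.+1]/= na/=.
set A := EFin @` _ => At.
have lbA : (a%:E <= ereal_inf A)%E.
  by apply: le_ereal_inf_tmp => _ /= [r [lt_t _] <-]; exact: ltW.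
have [b Ab] : exists b, ereal_inf A = b%:E.
  by case: (ereal_inf A) lbA At => [b _ _|//|//]; exists b.
rewrite Ab in lbA At *; rewrite !lee_fin in lbA At.
exists b; split=> //.
  rewrite leNgt; apply/negP => yb.
  have [d d0 yd] := yr b (e - `|y b - y a|) (le_trans a0 lbA) ltac:(lra).
  (* Otherwise right continuity keeps the path inside up to the time b + d. *)
  have : ((b + d)%:E <= ereal_inf A)%E.
    apply: le_ereal_inf_tmp => _ /= [r [ar er] <-]; rewrite lee_fin leNgt; apply/negP => rd.
    have br : b <= r by rewrite -lee_fin -Ab; apply: ereal_inf_lbound; exists r.
    have := yd r br rd; have := ler_normD (y r - y b) (y b - y a).
    by rewrite addrA subrK; lra.
  by rewrite Ab lee_fin; lra.
move=> r ar rb; rewrite ltNge; apply/negP => er.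
move: ar; rewrite le_eqVlt => /predU1P[ar|ar].
  by move: er; rewrite ar subrr normr0; lra.
suff : (b%:E <= r%:E)%E by rewrite lee_fin; lra.
by rewrite -Ab; apply: ereal_inf_lbound; exists r => //; split => //; rewrite lte_fin.
Qed.

Lemma stays_within_last e y n a t : 0 < e ->
  hit_time e y n = a%:E -> (t%:E < hit_time e y n.+1)%E -> stays_within e y a t.
Proof.
move=> e0 na; rewrite [hit_time _ _ _.+1]/= na/=.
set A := EFin @` _ => At r ar rt.
rewrite ltNge; apply/negP => er.
move: ar; rewrite le_eqVlt => /predU1P[ar|ar].
  by move: er; rewrite ar subrr normr0; lra.
suff : (ereal_inf A <= r%:E)%E.
  by rewrite leNgt (lt_trans _ At)// lte_fin.
by apply: ereal_inf_lbound; exists r => //; split => //; rewrite lte_fin.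
Qed.

(** A continuous time change skips no value, so the untimed path visits
    between [s a] and [s b] only what the time-changed path visits before
    [b]. *)
Lemma stays_within_time_change e x s a b : a <= b ->
  {within `[a, b], continuous s} -> (forall u v, a <= u -> u <= v -> s u <= s v) ->
  stays_within e (x \o s) a b -> stays_within e x (s a) (s b).
Proof.
move=> ab sc smon st p sap psb.
have sab := smon _ _ (lexx a) ab.
have [|r] := @IVT R s a b p ab sc.
  by rewrite min_l// max_r// sap ltW.
rewrite in_itv/= => /andP[ar rb] rp; rewrite -rp; apply: st => //.
by rewrite lt_neqAle rb andbT; apply/eqP => rb'; move: psb; rewrite -rp rb' ltxx.
Qed.

Lemma V_pathE e f y n t : (hit_time e y n <= t%:E)%E ->
  (t%:E < hit_time e y n.+1)%E ->
  V_path e f y t = \sum_(i < n)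
    f ((y (fine (hit_time e y i.+1)) - y (fine (hit_time e y i))) / e).
Proof.
move=> nt tn; rewrite /V_path.
have -> : [set i : nat | (0 < i)%N /\ (hit_time e y i <= t%:E)%E] = [set` index_iota 1 n.+1].
  apply/seteqP; split=> i /=; rewrite mem_index_iota.
    move=> [-> it]/=; rewrite ltnNge; apply/negP => ni.
    have := hit_time_nondecreasing e y ni.
    by rewrite leNgt (le_lt_trans it).
  move=> /andP[-> ]; rewrite ltnS => ni; split=> //.
  by rewrite (le_trans _ nt)// hit_time_nondecreasing.
rewrite -fsbig_seq ?iota_uniq// big_add1 big_mkord.
by apply: eq_bigr => i _; rewrite mulrC.
Qed.

Definition time_change_path s : Prop :=
  [/\ s 0 = 0, {within `[0, +oo[, continuous s} &
      forall u v, 0 <= u -> u <= v -> s u <= s v].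

Lemma hit_time_exit_chain e x s n t : 0 < e ->
  (forall r, 0 <= r -> x u @[u --> r^'+] --> x r) -> time_change_path s ->
  (hit_time e (x \o s) n <= t%:E)%E ->
  let T i := hit_time e (x \o s) i in
  [/\ exit_chain e x (fun i => s (fine (T i))) n, T n = (fine (T n))%:E,
      0 <= fine (T n) & fine (T n) <= t].
Proof.
move=> e0 xr [s0 sc smon]; set y := x \o s.
have yr : right_continuous_from0 y.
  move=> r eta r0 eta0; apply: (right_continuous_comp xr sc smon r0 _ eta0).
  by rewrite -[leLHS]s0 smon.
elim: n => [t0|n IHn nt] T; first by rewrite /T/=; split=> //; split.
have [//|[Hn HS] Tn Tn0 Tnt] := IHn; first by rewrite (le_trans _ nt)// hit_time_nondecreasing.
have [b [Tb ab bt exb inb]] := hit_timeS e0 yr Tn0 Tn nt.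
rewrite /T Tb/= ; split=> //; last exact: le_trans ab.
split=> // i; rewrite ltnS leq_eqVlt => /predU1P[->|]; last exact: HS.
rewrite Tb/=; split=> //; first exact: smon.
apply: stays_within_time_change => //.
  apply: continuous_subspaceW sc => r /=; rewrite !in_itv/= => /andP[ar _].
  by rewrite (le_trans _ ar).
by move=> u v au; apply: smon; exact: le_trans au.
Qed.

Lemma V_path_bound c e K W z F f M L s t (x := drifted c z) : c != 0 -> 0 < e ->
  controls K e z F -> (forall r, 0 <= r < K -> 0 <= F r <= W) ->
  (forall r, 0 <= r -> x u @[u --> r^'+] --> x r) -> time_change_path s ->
  0 <= t -> s t < K -> 0 <= L ->
  (forall v, `|f v| <= M) -> (forall v v', `|f v - f v'| <= L * `|v - v'|) ->
  `|e * V_path e f (x \o s) t - f (Num.sg c) * `|c| * s t| <=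
    (2 * L + 26 * M) * W + 3 * M * e.
Proof.
move=> c0 e0 Fz FW xr tcs t0 stK L0 fM fL; have [s0 sc smon] := tcs.
pose T i := hit_time e (x \o s) i.
have chain n : (T n <= t%:E)%E -> _ := hit_time_exit_chain e0 xr tcs.
(* The hitting times exceed t eventually, since each exit uses up either
   drift or variation. *)
have [n [nt tn]] : exists n, (T n <= t%:E)%E /\ (t%:E < T n.+1)%E.
  have [N tN] : exists N, (t%:E < T N)%E.
    apply: contrapT => /forallNP H.
    have {}H n : (T n <= t%:E)%E by rewrite leNgt; apply/negP => nt; apply: (H n); rewrite nt.
    have bound n : e * n%:R <= `|c| * s t + 15 * W.
      have [ch Tn Tn0 Tnt] := chain _ (H n).
      have sn : s (fine (T n)) <= s t by apply: smon.
      have := exit_chain_count c0 e0 Fz ch (le_lt_trans sn stK).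
      have sn0 := exit_chain_ge0 ch.
      have := FW (s (fine (T n))); rewrite sn0 (le_lt_trans sn stK) => /(_ isT)/andP[_ FnW].
      have := FW 0; rewrite lexx (le_lt_trans (le_trans sn0 sn) stK) => /(_ isT)/andP[F00 _].
      have : `|c| * s (fine (T n)) <= `|c| * s t by rewrite ler_wpM2l.
      by rewrite ler_norml => ? /andP[? _]; lra.
    have := bound (Num.truncn ((`|c| * s t + 15 * W) / e)).+1.
    by rewrite mulrC -ler_pdivlMr// leNgt truncnS_gt.
  elim: N tN => [|N IHN tN]; first by rewrite /T/= lte_fin ltNge t0.
  by have [/IHN//|NT] := ltP t%:E (T N); exists N.
have [ch Tn Tn0 Tnt] := chain _ nt.
rewrite (V_pathE f nt tn); apply: (exit_chain_bound c0 e0 Fz FW ch _ stK _ L0 fM fL).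
  exact: smon.
apply: stays_within_time_change => //.
- apply: continuous_subspaceW sc => r /=; rewrite !in_itv/= => /andP[ar _].
  by rewrite (le_trans _ ar).
- by move=> u v au; apply: smon; exact: le_trans au.
- exact: stays_within_last Tn tn.
Qed.

Lemma time_changed_error c e W f M L x s (n : nat) t : c != 0 -> 0 < e ->
  (forall r, 0 <= r -> x u @[u --> r^'+] --> x r) -> time_change_path s ->
  (forall m, dyadic_variation e (fun r => x r - c * r) n m <= W) ->
  0 <= t -> s t < n%:R -> 0 <= L ->
  (forall v, `|f v| <= M) -> (forall v v', `|f v - f v'| <= L * `|v - v'|) ->
  `|e * V_path e f (x \o s) t - f (Num.sg c) * `|c| * s t| <=
    (2 * L + 26 * M) * W + 3 * M * e.
Proof.
move=> c0 e0 xr tcs varW t0 stn L0 fM fL; set z := fun r => x r - c * r in varW.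
have zr r : 0 <= r -> z u @[u --> r^'+] --> z r.
  move=> r0; apply: cvgB; first exact: xr.
  by apply: cvg_at_right_filter; apply: mulrl_continuous.
have [F FW Fz] := variation_control (ltW e0) zr varW.
have xz : x = drifted c z by apply/funext => r; rewrite /drifted /z addrC subrK.
rewrite xz; apply: (V_path_bound c0 e0 Fz FW _ tcs t0 stn L0 fM fL).
by rewrite -xz.
Qed.

End TimeChange.

(** * Bounds by the jump weight *)

Section TrigonometricBounds.
Context {R : realType}.
Implicit Types (x u beta : R).

Lemma normr_sin_le x : `|sin x| <= `|x|.
Proof.
have pos (y : R) : 0 <= y -> `|sin y| <= y.
  move=> y0; have dsin (z : R) : z \in `]0, y[ -> is_derive z 1 (@sin R) (cos z).
    by move=> _; exact: is_derive_sin.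
  have csin : {within `[0, y], continuous (@sin R)}.
    exact/continuous_subspaceT/continuous_sin.
  have [r _] := MVT_segment y0 dsin csin; rewrite sin0 !subr0 => ->.
  by rewrite normrM (ger0_norm y0) ler_piMl// cos_max.
have [x0|x0] := lerP 0 x; first by rewrite [leRHS]ger0_norm// pos.
by rewrite -[leLHS]normrN -sinN [leRHS]ltr0_norm// pos// oppr_ge0 ltW.
Qed.

Lemma sin_max x : `|sin x| <= 1.
Proof. by rewrite ler_norml sin_geN1 sin_le1. Qed.

Lemma cos_double x : 1 - cos x = 2 * sin (x / 2) ^+ 2.
Proof.
have -> : cos x = cos (x / 2 + x / 2) by congr cos; field.
have := cos2Dsin2 (x / 2); rewrite cosD; lra.
Qed.

Lemma cos_le_normr x : 0 <= 1 - cos x <= `|x|.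
Proof.
rewrite subr_ge0 cos_le1/= cos_double -real_normK ?num_real//.
have h : `|sin (x / 2)| <= `|x| / 2.
  by apply: le_trans (normr_sin_le _) _; rewrite normrM (@ger0_norm _ 2^-1)// invr_ge0.
have : `|sin (x / 2)| ^+ 2 <= `|sin (x / 2)|.
  by rewrite expr2 ler_piMl// sin_max.
lra.
Qed.

(** This single function is integrable for a jump measure that integrates
    |x|^beta near 0, and dominates all the integrands of the characteristic
    exponent. *)
Definition jump_weight beta x : R := Num.min 1 (`|x| `^ beta).

Lemma jump_weight_ge0 beta x : 0 <= jump_weight beta x.
Proof. by rewrite /jump_weight le_min ler01 powR_ge0. Qed.

Lemma min_le_jump_weight beta u x : 0 < beta < 1 ->
  Num.min 1 `|u * x| <= (1 + `|u| `^ beta) * jump_weight beta x.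
Proof.
move=> /andP[b0 b1]; have ub := powR_ge0 `|u| beta.
have pb (y : R) : Num.min 1 `|y| <= `|y| `^ beta.
  have [->|y0] := eqVneq y 0; first by rewrite normr0 ge_min powR_ge0 orbT.
  have [y1|y1] := lerP `|y| 1.
    by rewrite ger1_powR ?(ltW b1)// y1 normr_gt0 y0.
  by have := ler_powR (ltW y1) (ltW b0); rewrite powRr0.
rewrite /jump_weight; have [k1|k1] := lerP 1 (`|x| `^ beta).
  by rewrite mulr1 ge_min; apply/orP; left; lra.
apply: le_trans (pb _) _; rewrite normrM powRM//.
by rewrite ler_wpM2r ?powR_ge0//; lra.
Qed.

Lemma sin_le_jump_weight beta u x : 0 < beta < 1 ->
  `|sin (u * x)| <= (1 + `|u| `^ beta) * jump_weight beta x.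
Proof.
move=> b01; apply: le_trans (min_le_jump_weight _ _ b01).
by rewrite le_min sin_max normr_sin_le.
Qed.

Lemma cos_le_jump_weight beta u x : 0 < beta < 1 ->
  `|1 - cos (u * x)| <= 2 * (1 + `|u| `^ beta) * jump_weight beta x.
Proof.
move=> b01; have := min_le_jump_weight u x b01.
have /andP[c0 c1] := cos_le_normr (u * x); have c2 := cos_geN1 (u * x).
by rewrite (ger0_norm c0) minEle; case: ifPn => _ ?; lra.
Qed.

Lemma truncation_le_jump_weight beta x : 0 < beta < 1 ->
  `|truncation x| <= 2 * jump_weight beta x.
Proof.
move=> b01; have := min_le_jump_weight 1 x b01; rewrite mul1r normr1 powR1.
suff : `|truncation x| <= Num.min 1 `|x| by lra.
rewrite /truncation le_min !ler_norml; have := ler_norm x; have := ler_norm (- x).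
rewrite normrN !maxEle !minEle => ? ?.
by apply/andP; split; apply/andP; split; case: ifPn; try case: ifPn; rewrite -?ltNge => *; lra.
Qed.

Lemma measurable_jump_weight beta : measurable_fun setT (jump_weight beta).
Proof.
apply: measurable_minr => //.
by apply: (measurableT_comp (measurable_powR beta)) => //; exact: measurable_normr.
Qed.

End TrigonometricBounds.

(** * The characteristic exponent *)

Section LevyExponent.
Context {R : realType}.
Implicit Types (nu : {measure set R -> \bar R}) (beta gamma u r : R).

Lemma cexp_imaginary r : cexp ('i%C * (r%:C)%C) = (cos r +i* sin r)%C.
Proof.
rewrite /cexp /=; apply/eqP; rewrite eq_complex /=; apply/andP; split; apply/eqP.
  by rewrite !mul0r !mul1r oppr0 ?(add0r, addr0, subr0, mulr0) expR0 mul1r.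
by rewrite !mul0r !mul1r ?(add0r, addr0, subr0, mulr0, sub0r, oppr0) expR0 mul1r.
Qed.

Lemma integrable_jump_weight nu beta : levy_measure nu ->
  (\int[nu]_(x in [set x : R | (`|x| <= 1)%R]) (`|x| `^ beta)%:E < +oo)%E ->
  nu.-integrable setT (EFin \o jump_weight beta).
Proof.
move=> [_ nu2] nub; pose D := [set x : R | `|x| <= 1].
have mD : measurable D.
  rewrite (_ : D = `[-1, 1]%classic); first exact: measurable_itv.
  by apply/seteqP; split=> x; rewrite /D /= in_itv/= ler_norml.
have mpow : measurable_fun setT (fun x : R => `|x| `^ beta).
  by apply: (measurableT_comp (measurable_powR beta)) => //; exact: measurable_normr.
have i1 : nu.-integrable setT ((fun x => (`|x| `^ beta)%:E) \_ D).
  apply/(integrable_mkcond _ mD); apply/integrableP; split.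
    by apply/measurable_EFinP; exact: measurable_funTS.
  by under eq_integral do rewrite gee0_abs ?lee_fin ?powR_ge0//.
have i2 : nu.-integrable setT (fun x => (Num.min 1 (x ^+ 2))%:E).
  apply/integrableP; split.
    by apply/measurable_EFinP; apply: measurable_minr => //; exact: measurable_funX.
  under eq_integral do rewrite gee0_abs ?lee_fin ?le_min ?ler01 ?sqr_ge0//.
  exact: nu2.
apply: le_integrable (integrableD measurableT i1 i2) => //.
  by apply/measurable_EFinP; exact: measurable_jump_weight.
move=> x _ /=; have w0 := jump_weight_ge0 beta x; have p0 := powR_ge0 `|x| beta.
have m0 : 0 <= Num.min 1 (x ^+ 2) by rewrite le_min ler01 sqr_ge0.
rewrite patchE; case: ifPn => xD.
  rewrite -EFinD lee_fin [leLHS]ger0_norm// [leRHS]ger0_norm ?addr_ge0//.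
  by apply: (@le_trans _ _ (`|x| `^ beta)); rewrite ?lerDl// ge_min lexx orbT.
rewrite [X in `|X + _|%E](_ : _ = 0%E)// add0e lee_fin [leLHS]ger0_norm// [leRHS]ger0_norm//.
have x1 : 1 < `|x| by rewrite ltNge; apply: contra xD => ?; rewrite inE.
have x2 : 1 <= x ^+ 2 by rewrite -real_normK ?num_real// exprn_ege1// ltW.
by rewrite (min_l x2) ge_min lexx.
Qed.

Lemma weighted_integral nu beta C (g : R -> R) :
  nu.-integrable setT (EFin \o jump_weight beta) -> measurable_fun setT g ->
  (forall x, `|g x| <= C * jump_weight beta x) ->
  nu.-integrable setT (EFin \o g) /\
  `|\int[nu]_x g x| <= C * \int[nu]_x jump_weight beta x.
Proof.
move=> iw mg gC.
have iCw : nu.-integrable setT (EFin \o (fun x => C * jump_weight beta x)).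
  by apply: (integrableZl measurableT C) iw.
have ig : nu.-integrable setT (EFin \o g).
  apply: le_integrable iCw => //; first exact/measurable_EFinP.
  move=> x _ /=; rewrite lee_fin; apply: le_trans (gC x) _; exact: ler_norm.
split => //; apply: le_trans (le_normr_Rintegral measurableT ig) _.
rewrite -RintegralZl//; apply: le_Rintegral => //.
exact: (integrable_abse ig).
Qed.

Definition cos_exponent nu u : R := \int[nu]_x (1 - cos (u * x)).
Definition sin_exponent nu u : R := \int[nu]_x sin (u * x).

Lemma measurable_cosM u : measurable_fun setT (fun x : R => cos (u * x)).
Proof.
apply: continuous_measurable_fun => x; apply: continuous_comp; last exact: continuous_cos.
exact: mulrl_continuous.
Qed.

Lemma measurable_sinM u : measurable_fun setT (fun x : R => sin (u * x)).
Proof.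
apply: continuous_measurable_fun => x; apply: continuous_comp; last exact: continuous_sin.
exact: mulrl_continuous.
Qed.

Lemma measurable_truncation : measurable_fun setT (@truncation R).
Proof. by apply: measurable_maxr => //; apply: measurable_minr. Qed.

Lemma exponent_bound nu beta u (k := \int[nu]_x jump_weight beta x) :
  0 < beta < 1 -> nu.-integrable setT (EFin \o jump_weight beta) ->
  0 <= cos_exponent nu u /\
  cos_exponent nu u + `|sin_exponent nu u| <= 3 * k * (1 + `|u| `^ beta).
Proof.
move=> b01 iw; split.
  by apply: Rintegral_ge0 => x _; rewrite subr_ge0 cos_le1.
have [||_ ac] := @weighted_integral nu beta (2 * (1 + `|u| `^ beta)) (fun x => 1 - cos (u * x)) iw.
- by apply: measurable_funB => //; exact: measurable_cosM.
- by move=> x; exact: cos_le_jump_weight.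
have [||_ bc] := @weighted_integral nu beta (1 + `|u| `^ beta) (fun x => sin (u * x)) iw.
- exact: measurable_sinM.
- by move=> x; exact: sin_le_jump_weight.
by have := ler_norm (cos_exponent nu u); rewrite /cos_exponent /sin_exponent -/k in ac bc *; lra.
Qed.

(** All terms of the compensated integrand are integrable separately, so the
    truncation can be moved into the drift. *)
Lemma levy_exponent_bounded_variation nu beta gamma u : 0 < beta < 1 ->
  nu.-integrable setT (EFin \o jump_weight beta) ->
  levy_exponent 0 nu gamma u =
    (- cos_exponent nu u +i* (drift0 nu gamma * u + sin_exponent nu u))%C.
Proof.
move=> b01 iw.
have [||ic _] := @weighted_integral nu beta (2 * (1 + `|u| `^ beta)) (fun x => 1 - cos (u * x)) iw.
- by apply: measurable_funB => //; exact: measurable_cosM.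
- by move=> x; exact: cos_le_jump_weight.
have [||isin _] := @weighted_integral nu beta (1 + `|u| `^ beta) (fun x => sin (u * x)) iw.
- exact: measurable_sinM.
- by move=> x; exact: sin_le_jump_weight.
have [||it _] := @weighted_integral nu beta 2 (@truncation R) iw.
- exact: measurable_truncation.
- by move=> x; exact: truncation_le_jump_weight.
have itu : nu.-integrable setT (EFin \o (fun x => u * truncation x)).
  exact: (integrableZl measurableT u) it.
have intRe : \int[nu]_x complex.Re (cexp ('i%C * (u * x)%:C%C) - 1 -
    'i%C * (u * truncation x)%:C%C) = - cos_exponent nu u.
  rewrite /cos_exponent -[RHS]mulN1r -RintegralZl//; apply: eq_Rintegral => x _.
  by rewrite cexp_imaginary /=; ring.
have intIm : \int[nu]_x complex.Im (cexp ('i%C * (u * x)%:C%C) - 1 -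
    'i%C * (u * truncation x)%:C%C) =
    sin_exponent nu u - u * \int[nu]_x truncation x.
  rewrite /sin_exponent -RintegralZl// -RintegralB//; apply: eq_Rintegral => x _.
  by rewrite cexp_imaginary /=; ring.
rewrite /levy_exponent /Cintegral intRe intIm; apply/eqP; rewrite eq_complex.
by apply/andP; split; apply/eqP => /=; rewrite ?/drift0; ring.
Qed.

End LevyExponent.

(** * From the characteristic function to tails *)

Section TailBound.
Context {R : realType} d {T : measurableType d}.
Implicit Types (P : probability T R) (Z Y : T -> R).

Lemma measurable_cos_comp Y (u : R) : measurable_fun setT Y ->
  measurable_fun setT (fun w => cos (u * Y w)).
Proof. by move=> mY; exact: (measurableT_comp (measurable_cosM u) mY). Qed.

Lemma measurable_sin_comp Y (u : R) : measurable_fun setT Y ->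
  measurable_fun setT (fun w => sin (u * Y w)).
Proof. by move=> mY; exact: (measurableT_comp (measurable_sinM u) mY). Qed.

Lemma integrable_bounded P Y (M : R) : measurable_fun setT Y ->
  (forall w, `|Y w| <= M) -> P.-integrable setT (EFin \o Y).
Proof.
move=> mY YM; apply: (@le_integrable _ _ _ _ _ measurableT _ (EFin \o cst M)).
- exact/measurable_EFinP.
- by move=> w _ /=; rewrite lee_fin (le_trans (YM w))// ler_norm.
- exact: finite_measure_integrable_cst.
Qed.

Lemma char_functionE P Z (u : R) : char_function P Z u =
  ((\int[P]_w cos (u * Z w)) +i* (\int[P]_w sin (u * Z w)))%C.
Proof.
rewrite /char_function /Cintegral; congr Complex;
  by apply: eq_Rintegral => w _; rewrite cexp_imaginary.
Qed.

Lemma cexp_real_scale (h a b : R) :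
  cexp ((h%:C)%C * (a +i* b)%C) = (expR (h * a) * cos (h * b) +i* (expR (h * a) * sin (h * b)))%C.
Proof.
rewrite /cexp; apply/eqP; rewrite eq_complex /= !mul0r subr0 !addr0 subr0.
by rewrite !eqxx.
Qed.

Lemma expectation_cos P Z nu beta gamma (h u : R)
    (c := drift0 nu gamma) : 0 < beta < 1 ->
  nu.-integrable setT (EFin \o jump_weight beta) -> measurable_fun setT Z ->
  char_function P Z u = cexp ((h%:C)%C * levy_exponent 0 nu gamma u) ->
  \int[P]_w cos (u * (Z w - c * h)) =
    expR (- (h * cos_exponent nu u)) * cos (h * sin_exponent nu u).
Proof.
move=> b01 iw mZ; rewrite (levy_exponent_bounded_variation gamma u b01 iw) -/c.
set a := cos_exponent nu u; set b := sin_exponent nu u.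
rewrite char_functionE cexp_real_scale mulrN => -[Ecos Esin].
have ic : P.-integrable setT (EFin \o (fun w => cos (u * Z w))).
  by apply: (@integrable_bounded _ _ 1) => [|w]; [exact: measurable_cos_comp|exact: cos_max].
have isin : P.-integrable setT (EFin \o (fun w => sin (u * Z w))).
  by apply: (@integrable_bounded _ _ 1) => [|w]; [exact: measurable_sin_comp|exact: sin_max].
have icM : P.-integrable setT (EFin \o (fun w => cos (u * (c * h)) * cos (u * Z w))).
  exact: (integrableZl measurableT _ ic).
have isM : P.-integrable setT (EFin \o (fun w => sin (u * (c * h)) * sin (u * Z w))).
  exact: (integrableZl measurableT _ isin).
transitivity (\int[P]_w (cos (u * (c * h)) * cos (u * Z w) + sin (u * (c * h)) * sin (u * Z w))).
  by apply: eq_Rintegral => w _; rewrite mulrBr cosB; ring.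
rewrite (RintegralD measurableT icM isM) (RintegralZl _ measurableT ic)
  (RintegralZl _ measurableT isin).
rewrite Ecos Esin (_ : h * b = h * (c * u + b) - u * (c * h)); last by ring.
by rewrite cosB; ring.
Qed.

(** With A = h times [cos_exponent] and B = h times [sin_exponent], the
    expectation is 1 - exp(-A) cos B, which is at most A + |B|. *)
Lemma expectation_cos_bound P Z nu beta gamma (h u : R)
    (c := drift0 nu gamma) (k := \int[nu]_x jump_weight beta x) : 0 < beta < 1 ->
  nu.-integrable setT (EFin \o jump_weight beta) -> measurable_fun setT Z -> 0 <= h ->
  char_function P Z u = cexp ((h%:C)%C * levy_exponent 0 nu gamma u) ->
  \int[P]_w (1 - cos (u * (Z w - c * h))) <= h * (3 * k * (1 + `|u| `^ beta)).
Proof.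
move=> b01 iw mZ h0 charE.
have mZc : measurable_fun setT (fun w => Z w - c * h) by apply: measurable_funB.
have ic : P.-integrable setT (EFin \o (fun w => cos (u * (Z w - c * h)))).
  by apply: (@integrable_bounded _ _ 1) => [|w]; [exact: measurable_cos_comp|exact: cos_max].
have i1 : P.-integrable setT (EFin \o (cst 1 : T -> R)) by exact: finite_measure_integrable_cst.
rewrite (RintegralB measurableT i1 ic) (expectation_cos b01 iw mZ charE).
rewrite Rintegral_cst// mul1r; have -> : fine (P setT) = 1 by rewrite probability_setT.
have [a0 ab] := exponent_bound u b01 iw; rewrite -/k in ab.
apply: le_trans (ler_wpM2l h0 ab); set a := cos_exponent nu u in a0 *; set b := sin_exponent nu u.
have ha0 : 0 <= h * a by rewrite mulr_ge0.
have := expR_ge1Dx (- (h * a)); have := expR_gt0 (- (h * a)).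
have : expR (- (h * a)) <= 1 by rewrite expR_le1 oppr_le0.
have /andP[cb0 cb1] := cos_le_normr (h * b); rewrite normrM (ger0_norm h0) in cb1.
set E := expR _ => E1 E0 Ea.
have : E * (1 - cos (h * b)) <= 1 * (h * `|b|) by apply: ler_pM => //; exact: ltW.
lra.
Qed.

Lemma derive_sinc (y u : R) : y != 0 ->
  is_derive u 1 (fun v : R => v - y^-1 * sin (y * v)) (1 - cos (u * y)).
Proof.
move=> y0.
have d1 : is_derive u 1 (fun v : R => sin (y * v)) (cos (y * u) * y).
  have dy : is_derive u 1 (fun v : R => y * v) y.
    by apply: is_derive_eq; rewrite /GRing.scale/= mulr1.
  exact: (@is_derive1_comp _ (@sin R) (fun v : R => y * v) u).
apply: is_derive_eq; rewrite /GRing.scale/= (mulrC u); by field.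
Qed.

(** The integral is 1 - sin y / y. *)
Lemma sinc_integral (y : R) : 2 <= `|y| ->
  ((1 / 2)%:E <= \int[lebesgue_measure]_(u in `[0%R, 1%R]) (1 - cos (u * y))%:E)%E.
Proof.
move=> y2; have y0 : y != 0 by rewrite -normr_gt0; lra.
pose F (v : R) := v - y^-1 * sin (y * v).
have dF (u : R) : is_derive u 1 F (1 - cos (u * y)) by exact: derive_sinc.
have cF : continuous F.
  by move=> u; apply: differentiable_continuous; apply/derivable1_diffP; exact: ex_derive.
rewrite (@continuous_FTC2 _ (fun u => 1 - cos (u * y)) F 0 1)//.
- rewrite -EFinB lee_fin /F !mulr0 sin0 mulr0 subr0 subr0 mulr1.
  have : `|y^-1 * sin y| <= 2^-1 * 1.
    rewrite normrM; apply: ler_pM => //; last exact: sin_max.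
    by rewrite normfV lef_pV2// posrE; lra.
  by rewrite ler_norml => /andP[_]; lra.
- apply: continuous_subspaceT => u; apply: cvgB; first exact: cvg_cst.
  apply: continuous_comp; last exact: continuous_cos.
  exact: mulrr_continuous.
- split.
  + by move=> u _; exact: ex_derive.
  + by apply: cvg_at_right_filter; exact: cF.
  + by apply: cvg_at_left_filter; exact: cF.
- by move=> u _; rewrite derive1E derive_val.
Qed.

Lemma measurable_le_norm (e : R) Y : measurable_fun setT Y ->
  measurable [set w | e <= `|Y w|].
Proof.
move=> mY; have mnY : measurable_fun setT (fun w => `|Y w|) by apply: measurableT_comp.
have := mnY measurableT _ (measurable_itv `[e, +oo[); rewrite setTI.
by congr measurable; apply/seteqP; split=> w /=; rewrite in_itv/= andbT.
Qed.

(** Averaging 1 - cos (u y) over u in [0, 1] gives at least 1/2 as soon as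
    |y| >= 2; Tonelli's theorem exchanges this average with the
    expectation. *)
Lemma tail_bound P Y (B : R) : measurable_fun setT Y ->
  (forall u, 0 <= u <= 1 -> \int[P]_w (1 - cos (u * Y w)) <= B) ->
  (P [set w | (2 <= `|Y w|)%R] <= (2 * B)%:E)%E.
Proof.
move=> mY EB; pose mu := @lebesgue_measure R.
pose I : set R := `[0, 1]%classic.
pose g (p : T * R) : R := (1 - cos (p.2 * Y p.1)) * \1_I p.2.
have mI : measurable I by exact: measurable_itv.
have g0 p : 0 <= g p by rewrite mulr_ge0// subr_ge0 cos_le1.
have mg : measurable_fun setT g.
  apply: measurable_funM.
    apply: measurable_funB => //.
    apply: (measurableT_comp (f := @cos R)).
      by apply: continuous_measurable_fun; exact: continuous_cos.
    by apply: measurable_funM => //; exact: (measurableT_comp mY).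
  by apply: (measurableT_comp (f := \1_I : R -> R)).
have mEg : measurable_fun setT (EFin \o g) by exact/measurable_EFinP.
have Eg0 p : (0 <= (EFin \o g) p)%E by rewrite lee_fin.
have fub := @fubini_tonelli _ _ T (measurableTypeR R) R P mu (EFin \o g) mEg Eg0.
have inner w : (\int[mu]_u (EFin \o g) (w, u) = \int[mu]_(u in I) (1 - cos (u * Y w))%:E)%E.
  rewrite [RHS]integral_mkcond; apply: eq_integral => u _.
  by rewrite /= epatch_indic/= EFinM.
have B0 : 0 <= B.
  apply: le_trans (EB 0 _); last by rewrite lexx ler01.
  by apply: Rintegral_ge0 => w _; rewrite subr_ge0 cos_le1.
have outer u : (\int[P]_w (EFin \o g) (w, u) <= (B * \1_I u)%:E)%E.
  rewrite /g/= indicE; case: (boolP (u \in I)) => uI; last first.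
    under eq_integral do rewrite mulr0.
    by rewrite integral0 mulr0.
  under eq_integral do rewrite mulr1.
  rewrite mulr1 -(@fineK _ (integral _ _ _)).
    by rewrite lee_fin; apply: EB; move: uI; rewrite inE /I /= in_itv.
  apply: integrable_fin_num => //.
  apply: (@integrable_bounded _ _ 2).
    by apply: measurable_funB => //; exact: measurable_cos_comp.
  by move=> w; have := cos_le1 (u * Y w); have := cos_geN1 (u * Y w); rewrite ler_norml => *; lra.
pose A := [set w | 2 <= `|Y w|].
have mA : measurable A by exact: measurable_le_norm.
have half : ((1 / 2)%:E * P A <= \int[P]_w \int[mu]_u (EFin \o g) (w, u))%E.
  rewrite -integral_cst//; apply: (@le_trans _ _
    (\int[P]_(w in A) \int[mu]_u (EFin \o g) (w, u))%E).
    apply: ge0_le_integral => //.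
    - by move=> w _; rewrite lee_fin; lra.
    - apply: measurable_funTS; exact: measurable_fun_fubini_tonelli_F.
    - by move=> w Aw; rewrite [leRHS]inner; exact: sinc_integral.
  apply: ge0_subset_integral => //.
  - exact: measurable_fun_fubini_tonelli_F.
  - by move=> w _; apply: integral_ge0 => u _; exact: Eg0.
have total : (\int[mu]_u \int[P]_w (EFin \o g) (w, u) <= B%:E)%E.
  apply: (@le_trans _ _ (\int[mu]_u (B * \1_I u)%:E)%E).
    apply: ge0_le_integral => //.
    - by move=> u _; apply: integral_ge0 => w _; exact: Eg0.
    - exact: measurable_fun_fubini_tonelli_G.
    - by apply/measurable_EFinP; apply: measurable_funM.
  under eq_integral do rewrite EFinM.
  rewrite ge0_integralZl//; last by apply/measurable_EFinP.
  have -> : (\int[mu]_u (\1_I u)%:E = 1)%E; last by rewrite mule1.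
  rewrite integral_indic// setIT; apply: etrans (lebesgue_measure_itv `[0, 1]) _.
  by rewrite /= lte_fin ltr01 -EFinB subr0.
have : ((1 / 2)%:E * P A <= B%:E)%E by rewrite (le_trans half)// fub.
rewrite -(@fineK _ (P A)) ?fin_num_measure//; rewrite -EFinM !lee_fin; lra.
Qed.

End TailBound.

(** * Expected variation of the compensated process *)

Section CappedExpectation.
Context {R : realType} d {T : measurableType d}.
Implicit Types (P : probability T R) (X : R -> T -> R) (Z Y : T -> R).

Lemma increment_tail P Z nu beta gamma (h a : R)
    (c := drift0 nu gamma) (k := \int[nu]_x jump_weight beta x) : 0 < beta < 1 ->
  nu.-integrable setT (EFin \o jump_weight beta) -> measurable_fun setT Z -> 0 <= h ->
  (forall u, char_function P Z u = cexp ((h%:C)%C * levy_exponent 0 nu gamma u)) ->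
  0 < a <= 1 ->
  (P [set w | (2 * a <= `|Z w - c * h|)%R] <= (12 * k * h * a `^ (- beta))%:E)%E.
Proof.
move=> b01 iw mZ h0 charE /andP[a0 a1]; have /andP[b0 b1] := b01.
have k0 : 0 <= k by apply: Rintegral_ge0 => x _; exact: jump_weight_ge0.
have aV : 0 <= a^-1 by rewrite invr_ge0 ltW.
have ab1 : 1 <= a `^ (- beta).
  by rewrite -[leLHS](powRr0 a); apply: ger_powR; rewrite ?a0 ?a1// oppr_le0 ltW.
have -> : [set w | 2 * a <= `|Z w - c * h|] = [set w | 2 <= `|(Z w - c * h) / a|].
  apply/seteqP; split=> w /=; rewrite normrM normfV (gtr0_norm a0) ler_pdivlMr//.
rewrite (_ : 12 * k * h * _ = 2 * (6 * k * h * a `^ (- beta))); last by ring.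
apply: tail_bound => [|u /andP[u0 u1]].
  by apply: measurable_funM => //; apply: measurable_funB.
have -> : \int[P]_w (1 - cos (u * ((Z w - c * h) / a))) =
    \int[P]_w (1 - cos (u / a * (Z w - c * h))).
  by apply: eq_Rintegral => w _; congr (1 - cos _); ring.
apply: le_trans (expectation_cos_bound b01 iw mZ h0 (charE _)) _; rewrite -/k.
have ub : `|u / a| `^ beta <= a `^ (- beta).
  rewrite ger0_norm ?mulr_ge0// -[leRHS]mul1r powRM// -[X in _ * X `^ _ <= _]powR_inv1 ?(ltW a0)//.
  rewrite -powRrM mulN1r ler_wpM2r ?powR_ge0//.
  by rewrite -[leRHS](congr1 (fun g => g beta) (powR1 R)) ge0_ler_powR ?nnegrE// ltW.
have hk : 0 <= h * k by rewrite mulr_ge0.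
have : h * k * (1 + `|u / a| `^ beta) <= h * k * (2 * a `^ (- beta)).
  by rewrite ler_wpM2l//; lra.
lra.
Qed.

Lemma Rintegral_indicZ P (A : set T) (c : R) : measurable A ->
  P.-integrable setT (EFin \o (fun w => c * \1_A w)) /\
  \int[P]_w (c * \1_A w) = c * fine (P A).
Proof.
move=> mA; have iA : P.-integrable setT (EFin \o (\1_A : T -> R)).
  apply: (@integrable_bounded _ _ _ _ _ 1) => [|w]; first exact: measurable_indic.
  by rewrite indicE; case: (_ \in _); rewrite ?normr1 ?normr0.
split; first exact: (integrableZl measurableT _ iA).
by rewrite (RintegralZl _ measurableT iA) /Rintegral integral_indic// setIT.
Qed.

Lemma measurable_capped (e : R) : measurable_fun setT (capped e).
Proof. by apply: measurable_minr => //; exact: measurable_normr. Qed.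

Lemma integrable_capped P Y (e : R) : 0 <= e -> measurable_fun setT Y ->
  P.-integrable setT (EFin \o (fun w => capped e (Y w))).
Proof.
move=> e0 mY; apply: (@integrable_bounded _ _ _ _ _ e) => [|w].
  exact: (measurableT_comp (measurable_capped e) mY).
by rewrite ger0_norm ?capped_ge0 ?capped_le.
Qed.

(** Passing from the cap [e] to [e / 2] matters only where |Y| >= e/2, and
    costs at most [e] there. *)
Lemma capped_halving P Y (e p : R) : 0 < e -> measurable_fun setT Y ->
  (P [set w | (e / 2 <= `|Y w|)%R] <= p%:E)%E ->
  \int[P]_w capped e (Y w) <= e * p + \int[P]_w capped (e / 2) (Y w).
Proof.
move=> e0 mY tail; have e2 : 0 <= e / 2 by lra.
pose A := [set w | e / 2 <= `|Y w|].
have mA : measurable A by exact: measurable_le_norm.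
have [iA EA] := Rintegral_indicZ P e mA.
have ic := integrable_capped P (ltW e0) mY; have ic2 := integrable_capped P e2 mY.
apply: (@le_trans _ _ (\int[P]_w (e * \1_A w + capped (e / 2) (Y w)))).
  apply: le_Rintegral => //; first exact: (integrableD measurableT iA ic2).
  move=> w _; rewrite indicE /A; have c0 := capped_ge0 (Y w) e2.
  case: (boolP (w \in _)) => wA.
    by rewrite mulr1; have := capped_le e (Y w); lra.
  have {}wA : `|Y w| < e / 2 by rewrite ltNge; apply: contra wA => ?; rewrite inE.
  by rewrite mulr0 add0r /capped !min_l//; lra.
rewrite (RintegralD measurableT iA ic2) EA lerD2r ler_wpM2l ?(ltW e0)//.
by rewrite -lee_fin fineK ?fin_num_measure.
Qed.

(** Iterated halving; the costs form a geometric series because the ratio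
    [q] is below 1 for [beta] < 1. *)
Lemma capped_expectation P Y (D beta e : R) (q := (2^-1) `^ (1 - beta)) : 0 < beta < 1 ->
  measurable_fun setT Y -> 0 <= D ->
  (forall a, 0 < a <= 1 -> (P [set w | (2 * a <= `|Y w|)%R] <= (D * a `^ (- beta))%:E)%E) ->
  0 < e <= 1 ->
  \int[P]_w capped e (Y w) <= D * (4^-1 `^ (- beta) / (1 - q)) * e `^ (1 - beta).
Proof.
move=> /andP[b0 b1] mY D0 tail e01.
have q0 : 0 <= q := powR_ge0 _ _.
have q1 : q < 1.
  rewrite /q -[ltRHS](congr1 (fun g => g (1 - beta)) (powR1 R)).
  by rewrite gt0_ltr_powR ?nnegrE ?subr_gt0// invf_lt1// ltr1n.
set C := D * _; have CE : C * (1 - q) = D * 4^-1 `^ (- beta).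
  by rewrite /C mulrA divfK// gt_eqF// subr_gt0.
suff H n : forall e, 0 < e <= 1 -> \int[P]_w capped e (Y w) <= C * e `^ (1 - beta) + e / 2 ^+ n.
  apply/ler_addgt0Pr => r r0; have := H (Num.truncn r^-1).+1 e e01.
  set n := (Num.truncn r^-1).+1.
  have n2 : r^-1 <= 2 ^+ n.
    apply: (@le_trans _ _ n%:R); first by rewrite ltW// truncnS_gt.
    by rewrite -natrX ler_nat ltnW// ltn_expl.
  have : e / 2 ^+ n <= 1 * r.
    move/andP: e01 => [e0 e1]; apply: ler_pM; rewrite ?invr_ge0 ?exprn_ge0 ?(ltW e0)//.
    by rewrite -[r]invrK lef_pV2// posrE ?invr_gt0// exprn_gt0.
  by lra.
elim: n {e e01} => [|n IHn] e /andP[e0 e1].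
  rewrite expr0 divr1; apply: (@le_trans _ _ e); last first.
    rewrite lerDr mulr_ge0 ?powR_ge0// mulr_ge0// divr_ge0 ?powR_ge0//; lra.
  have ie : P.-integrable setT (EFin \o (cst e : T -> R)) by exact: finite_measure_integrable_cst.
  apply: le_trans (le_Rintegral measurableT (integrable_capped P (ltW e0) mY) ie _) _.
    by move=> w _; exact: capped_le.
  rewrite Rintegral_cst// (_ : fine (P setT) = 1) ?mulr1//.
  by rewrite probability_setT.
have e4 : 0 < e / 4 <= 1 by apply/andP; split; lra.
have := tail _ e4; rewrite (_ : 2 * (e / 4) = e / 2); last by field.
move=> /(capped_halving e0 mY) /le_trans; apply.
have : 0 < e / 2 <= 1 by apply/andP; split; lra.
move=> /IHn /(lerD (lexx (e * (D * (e / 4) `^ (- beta))))) /le_trans; apply.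
have -> : (e / 2) `^ (1 - beta) = e `^ (1 - beta) * q by rewrite powRM ?(ltW e0).
have -> : e * (D * (e / 4) `^ (- beta)) = e `^ (1 - beta) * (C * (1 - q)).
  rewrite CE powRM ?(ltW e0)// powRD ?powRr1 ?(ltW e0)//; first by ring.
  by rewrite (gt_eqF e0) implybT.
rewrite exprS invfM; lra.
Qed.

End CappedExpectation.

Section LevyVariation.
Context {R : realType} d {T : measurableType d}.
Implicit Types (P : probability T R) (X : R -> T -> R) (Y : T -> R).

Definition variation_constant (nu : {measure set R -> \bar R}) (beta : R) : R :=
  12 * (\int[nu]_x jump_weight beta x) *
  (4^-1 `^ (- beta) / (1 - 2^-1 `^ (1 - beta))).

(** Stationarity transfers the tail estimate to every increment. *)
Lemma levy_increment_expectation P X nu beta gamma (s h e : R)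
    (c := drift0 nu gamma) : 0 < beta < 1 ->
  nu.-integrable setT (EFin \o jump_weight beta) -> levy_process P X ->
  characteristic_triplet P X 0 nu gamma -> 0 <= s -> 0 <= h -> 0 < e <= 1 ->
  \int[P]_w capped e (X (s + h) w - X s w - c * h) <=
    h * (variation_constant nu beta * e `^ (1 - beta)).
Proof.
move=> b01 iw levyX [_ _ charX] s0 h0 e01.
have mX t : 0 <= t -> measurable_fun setT (X t) by exact: (levy_measurable levyX).
have mI : measurable_fun setT (fun w => X (s + h) w - X s w).
  by apply: measurable_funB; apply: mX => //; rewrite addr_ge0.
have k0 : 0 <= \int[nu]_x jump_weight beta x.
  by apply: Rintegral_ge0 => x _; exact: jump_weight_ge0.
have D0 : 0 <= 12 * (\int[nu]_x jump_weight beta x) * h by rewrite !mulr_ge0.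
have tail a : 0 < a <= 1 ->
    (P [set w | (2 * a <= `|X (s + h) w - X s w - c * h|)%R] <=
     (12 * (\int[nu]_x jump_weight beta x) * h * a `^ (- beta))%:E)%E.
  move=> a01; pose B := [set y : R | 2 * a <= `|y - c * h|].
  have mB : measurable B.
    by apply: (@measurable_le_norm R _ R (2 * a) (fun y => y - c * h)); apply: measurable_funB.
  rewrite [X in (X <= _)%E](levy_stationary levyX s0 h0 mB).
  by apply: (increment_tail b01 iw (mX _ h0) h0 _ a01) => u; exact: charX.
apply: le_trans (capped_expectation b01 _ D0 tail e01) _.
  by apply: measurable_funB.
by rewrite le_eqVlt /variation_constant; apply/orP; left; apply/eqP; ring.
Qed.

Lemma Rintegral_sum_le P (f : nat -> T -> R) (b : R) n :
  (forall k, P.-integrable setT (EFin \o f k)) -> (forall k, \int[P]_w f k w <= b) ->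
  P.-integrable setT (EFin \o (fun w => \sum_(0 <= k < n) f k w)) /\
  \int[P]_w (\sum_(0 <= k < n) f k w) <= n%:R * b.
Proof.
move=> intf fb; elim: n => [|n [IHi IHb]].
  rewrite (_ : (fun w => _) = cst 0); last by apply/funext => w; rewrite big_geq.
  split; first exact: finite_measure_integrable_cst.
  by rewrite Rintegral_cst// !mul0r.
rewrite (_ : (fun w => _) = (fun w => \sum_(0 <= k < n) f k w + f n w)); last first.
  by apply/funext => w; rewrite big_nat_recr.
split; first exact: (integrableD measurableT IHi (intf n)).
by rewrite (RintegralD measurableT IHi (intf n)) -natr1 mulrDl mul1r lerD.
Qed.

Lemma levy_variation_expectation P X nu beta gamma (e : R) (n m : nat)
    (z := fun w r => X r w - drift0 nu gamma * r) : 0 < beta < 1 ->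
  nu.-integrable setT (EFin \o jump_weight beta) -> levy_process P X ->
  characteristic_triplet P X 0 nu gamma -> 0 < e <= 1 ->
  P.-integrable setT (EFin \o (fun w => dyadic_variation e (z w) n m)) /\
  \int[P]_w dyadic_variation e (z w) n m <=
    n%:R * (variation_constant nu beta * e `^ (1 - beta)).
Proof.
move=> b01 iw levyX tripX e01; set c := drift0 nu gamma in z *.
have e0 : 0 <= e by case/andP: e01 => /ltW.
have p0 := @pow2_gt0 R m; set h : R := (2 ^ m)%:R^-1.
have h0 : 0 <= h by rewrite invr_ge0 ltW.
have dy0 k : 0 <= dyadic m k :> R by rewrite divr_ge0// ltW.
have zE w k : z w (dyadic m k.+1) - z w (dyadic m k) =
    X (dyadic m k + h) w - X (dyadic m k) w - c * h.
  have -> : dyadic m k.+1 = dyadic m k + h by rewrite /dyadic -natr1 mulrDl mul1r.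
  by rewrite /z; ring.
have int k : P.-integrable setT
    (EFin \o (fun w => capped e (z w (dyadic m k.+1) - z w (dyadic m k)))).
  apply: integrable_capped => //; under eq_fun do rewrite zE.
  apply: measurable_funB => //; apply: measurable_funB; apply: (levy_measurable levyX) => //.
  by rewrite addr_ge0.
have [|? le_int] := @Rintegral_sum_le P _
  (h * (variation_constant nu beta * e `^ (1 - beta))) (n * 2 ^ m) int.
  move=> k; under eq_Rintegral do rewrite zE.
  exact: levy_increment_expectation.
split => //; apply: le_trans le_int _.
by rewrite natrM mulrA mulfK// gt_eqF.
Qed.

Lemma markov_Rintegral P Y (W b : R) : 0 < W -> P.-integrable setT (EFin \o Y) ->
  (forall w, 0 <= Y w) -> \int[P]_w Y w <= b ->
  measurable [set w | W < Y w] /\ (P [set w | (W < Y w)%R] <= (b / W)%:E)%E.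
Proof.
move=> W0 iY Y0 Yb; pose A := [set w | W < Y w].
have mY : measurable_fun setT Y by have /integrableP[/measurable_EFinP] := iY.
have mA : measurable A.
  have := mY measurableT _ (measurable_itv `]W, +oo[); rewrite setTI.
  by congr measurable; apply/seteqP; split=> w /=; rewrite in_itv/= andbT.
split => //; have [iA EA] := Rintegral_indicZ P W mA.
rewrite -(@fineK _ (P _)) ?fin_num_measure// lee_fin ler_pdivlMr// mulrC -EA.
apply: le_trans Yb; apply: le_Rintegral => // w _.
rewrite indicE; case: (boolP (w \in A)) => wA; last by rewrite mulr0.
by rewrite mulr1; move: wA; rewrite inE => /ltW.
Qed.

(** The events increase with [m], so a bound uniform in [m] passes to their
    union. *)
Lemma levy_variation_exceeds P X nu beta gamma (e W : R) (n : nat)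
    (z := fun w r => X r w - drift0 nu gamma * r) : 0 < beta < 1 ->
  nu.-integrable setT (EFin \o jump_weight beta) -> levy_process P X ->
  characteristic_triplet P X 0 nu gamma -> 0 < e <= 1 -> 0 < W ->
  let A := \bigcup_m [set w | W < dyadic_variation e (z w) n m] in
  measurable A /\
  (P A <= (n%:R * (variation_constant nu beta * e `^ (1 - beta)) / W)%:E)%E.
Proof.
move=> b01 iw levyX tripX e01 W0 A; have e0 : 0 <= e by case/andP: e01 => /ltW.
have bound m := let H := levy_variation_expectation n m b01 iw levyX tripX e01 in
  markov_Rintegral W0 H.1 (fun w => sumr_ge0 _ (fun k _ => capped_ge0 _ e0)) H.2.
have mA m := (bound m).1.
have mU : measurable A by apply: bigcup_measurable => m _; exact: mA.
split => //.
have cvA : P [set w | W < dyadic_variation e (z w) n m] @[m --> \oo] --> P A.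
  apply: nondecreasing_cvg_mu => //.
  move=> m m' mm'; apply/subsetPset => w /= /lt_le_trans; apply.
  exact: dyadic_variation_nondecreasing.
rewrite -(cvg_lim _ cvA)//; apply: lime_le; first by apply/cvg_ex; exists (P A).
by apply: nearW => m; exact: (bound m).2.
Qed.

End LevyVariation.

(** * The limit constant *)

Section LimitConstantValue.
Context {R : realType} d {T : measurableType d}.

Lemma unit_exit_time_linear (c : R) : c != 0 ->
  unit_exit_time (fun t => c * t) = `|c|^-1.
Proof.
move=> c0; have cp : 0 < `|c| by rewrite normr_gt0.
rewrite /unit_exit_time (_ : [set t | _] = `[`|c|^-1, +oo[%classic).
  exact: inf_itv.
apply/seteqP; split=> t /=; rewrite in_itv/= andbT normrM.
  by move=> [t0]; rewrite (ger0_norm t0) -ler_pdivrMl// mulr1.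
move=> ct; have t0 : 0 <= t by apply: le_trans ct; rewrite invr_ge0.
by split => //; rewrite (ger0_norm t0) -ler_pdivrMl// mulr1.
Qed.

Lemma mean_limitE (P : probability T R) (c : R) (f : R -> R) : c != 0 ->
  mean_limit P (Xstar c) f = f (Num.sg c) * `|c|.
Proof.
move=> c0; rewrite /mean_limit.
have tauE (w : T) : unit_exit_time (Xstar c ^~ w) = `|c|^-1.
  exact: unit_exit_time_linear.
rewrite (_ : (fun w : T => unit_exit_time _) = cst `|c|^-1); last exact/funext.
rewrite (_ : (fun w : T => f _) = cst (f (Num.sg c))); last first.
  apply/funext => w; rewrite tauE /Xstar {1}[c]numEsg mulfK ?normr_eq0//.
by rewrite !expectation_cst/= invrK.
Qed.

End LimitConstantValue.

(** * Convergence in probability *)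

Section OuterProbability.
Context {R : realType} d {T : measurableType d}.
Implicit Types (P : probability T R).

Lemma cvge0_ge0 (F : set_system R) (g : R -> \bar R) : Filter F ->
  (forall x, 0 <= g x)%E ->
  (forall r : R, 0 < r -> \forall x \near F, (g x <= r%:E)%E) -> g x @[x --> F] --> 0%E.
Proof.
move=> FF g0 gr; have gfin r x : (g x <= r%:E)%E -> g x \is a fin_num.
  by move=> gx; rewrite ge0_fin_numE// (le_lt_trans gx) ?ltry.
apply/fine_cvgP; split; first by near do apply: (gfin 1); exact: gr.
apply/cvgrPdist_le => r r0; near=> x.
have gx : (g x <= r%:E)%E by near: x; exact: gr.
by rewrite sub0r normrN ger0_norm ?fine_ge0//= -lee_fin fineK ?(gfin r).
Unshelve. all: by end_near. Qed.

Lemma tight_random_variable P (Y : T -> R) (r : R) : measurable_fun setT Y -> 0 < r ->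
  exists n : nat, measurable [set w | n%:R <= Y w] /\
    (P [set w | (n%:R <= Y w)%R] <= r%:E)%E.
Proof.
move=> mY r0; pose B (n : nat) := [set w | n%:R <= Y w].
have mB n : measurable (B n).
  have := mY measurableT _ (measurable_itv `[n%:R, +oo[); rewrite setTI.
  by congr measurable; apply/seteqP; split=> w /=; rewrite in_itv/= andbT.
have B0 : \bigcap_n B n = set0.
  apply/seteqP; split=> // w Bw; have := Bw (Num.truncn (Y w)).+1 I.
  by rewrite /B/= leNgt truncnS_gt.
have : P (B n) @[n --> \oo] --> P (\bigcap_n B n).
  apply: nonincreasing_cvg_mu => //.
  - by rewrite -ge0_fin_numE ?fin_num_measure.
  - by rewrite B0.
  - move=> m n mn; apply/subsetPset => w; rewrite /B/=; apply: le_trans.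
    by rewrite ler_nat.
rewrite B0 measure0 => /fine_cvgP[_ /cvgr_le/(_ r r0)[n _ /(_ n (leqnn n))/=]].
rewrite -lee_fin fineK ?fin_num_measure// => Bn.
by exists n; split => //; exact: mB.
Qed.

End OuterProbability.

Lemma bounded_lipschitz_constants (R : realType) (f : R -> R) :
  [bounded f x | x in setT] -> lipschitz f ->
  exists M L : R, [/\ 0 <= L, forall v, `|f v| <= M &
    forall v v', `|f v - f v'| <= L * `|v - v'|].
Proof.
move=> [M [_ fM]] [L [_ fL]]; exists (M + 1), (Num.max L 0 + 1); split.
- by rewrite addr_ge0// le_max lexx orbT.
- by move=> v; apply: (fM (M + 1)) => //; rewrite ltrDl.
- move=> v v'; apply: (fL (Num.max L 0 + 1) _ (v, v')) => //.
  by rewrite ltr_pwDr// le_max lexx.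
Qed.

Theorem proposition4 (R : realType) (d : measure_display)
    (T : measurableType d) (P : probability T R)
    (X S : R -> T -> R)
    (A : R) (nu : {measure set R -> \bar R}) (gamma beta : R) (f : R -> R)
    (levyX : levy_process P X)
    (tripletX : characteristic_triplet P X A nu gamma)
    (A0 : A = 0)
    (nu1 : (\int[nu]_(x in [set x : R | (`|x| <= 1)%R]) `|x|%:E < +oo)%E)
    (gamma0_neq0 : drift0 nu gamma != 0)
    (beta01 : 0 < beta < 1)
    (nubeta : (\int[nu]_(x in [set x : R | (`|x| <= 1)%R])
                 (`|x| `^ beta)%:E < +oo)%E)
    (tcS : time_change P S)
    (f_bounded : [bounded f x | x in setT])
    (f_lipschitz : lipschitz f) :
  forall delta : R, 0 < delta ->
    ucp_cvg P
      (fun eps t w =>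
         eps `^ Num.max (- (1 - beta - delta)) (- (1 / 2)) *
         (eps * Vproc eps f (time_changed X S) t w
          - mean_limit P (Xstar (drift0 nu gamma)) f * S t w))
      (fun _ _ => 0).
Proof.
move=> delta delta0 a eta a0 eta0; subst A.
set c := drift0 nu gamma in gamma0_neq0 *; set rho := Num.max _ _.
have rho1 : - (1 - beta - delta) <= rho by rewrite le_max lexx.
have rho2 : - (1 / 2) <= rho by rewrite le_max lexx orbT.
have [M [L [L0 fM fL]]] := bounded_lipschitz_constants f_bounded f_lipschitz.
have M0 : 0 <= M := le_trans (normr_ge0 _) (fM 0).
have [_ levynu _] := tripletX.
have iw := integrable_jump_weight levynu nubeta.
rewrite (mean_limitE P f gamma0_neq0).
pose regular w := [/\ cadlag (X ^~ w), S 0 w = 0,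
  {within `[0, +oo[, continuous (S ^~ w)} &
  forall s t : R, 0 <= s -> s <= t -> S s w <= S t w].
have [N [mN PN Nregular]] : {ae P, forall w, regular w}.
  near=> w; split; near: w.
  - exact: levy_cadlag levyX.
  - exact: time_change_start tcS.
  - exact: time_change_continuous tcS.
  - exact: time_change_increasing tcS.
apply: cvge0_ge0 => [e|r r0]; first exact: mu_ext_ge0.
have small (u v : R) : 0 < u -> 0 < v -> \forall e \near 0^'+, e `^ u <= v.
  by move=> u0 v0; have /cvgr_le/(_ _ v0) := powR_cvg0 u0.
have [n [mB PB]] := tight_random_variable P
  (time_change_measurable tcS (ltW a0)) (divr_gt0 r0 (ltr0Sn R 1)).
set B := 2 * L + 26 * M; have B0 : 0 <= B by rewrite /B; lra.
have B1 : 0 < B + 1 by lra.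
pose eta' := eta / 2 / (B + 1).
have eta'0 : 0 < eta' by rewrite !divr_gt0.
have eta'E : (B + 1) * eta' = eta / 2 by rewrite mulrC divfK// gt_eqF.
set C := variation_constant nu beta.
(* 1 + rho >= 1/2 and 1 - beta + rho >= delta are positive. *)
have small1 : \forall e \near 0^'+, e `^ (1 + rho) <= eta / 2 / (3 * M + 1).
  by apply: small; [lra | rewrite !divr_gt0//; lra].
have nC0 : 0 < n%:R * `|C| / eta' + 1.
  have : 0 <= n%:R * `|C| / eta' by apply: divr_ge0; [exact: mulr_ge0|exact: ltW].
  lra.
have small2 : \forall e \near 0^'+, e `^ (1 - beta + rho) <= r / 2 / (n%:R * `|C| / eta' + 1).
  by apply: small; [lra | rewrite !divr_gt0].
near=> e.
have e0 : 0 < e by near: e; exact: nbhs_right_gt.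
have e1 : e <= 1 by near: e; apply: nbhs_right_le.
have er : 0 < e `^ rho by rewrite powR_gt0.
(* The largest variation that the pathwise estimate tolerates. *)
pose W := eta' / e `^ rho; have W0 : 0 < W by rewrite divr_gt0.
have e01 : 0 < e <= 1 by rewrite e0.
have [mA PA] := levy_variation_exceeds n beta01 iw levyX tripletX e01 W0.
set A := \bigcup_m _ in mA PA.
have good w : ~ N w -> S a w < n%:R -> ~ A w -> forall t, 0 <= t <= a ->
    `|e `^ rho * (e * Vproc e f (time_changed X S) t w - f (Num.sg c) * `|c| * S t w) - 0| <= eta.
  move=> Nw San nA t /andP[t0 ta].
  have [cadX S0 Sc Sm] : regular w by apply: contrapT => h; apply: Nw; exact: Nregular.
  have varW m : dyadic_variation e (fun s => X s w - c * s) n m <= W.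
    by rewrite leNgt; apply/negP => h; apply: nA; exists m.
  have Stn : S t w < n%:R by rewrite (le_lt_trans _ San)// Sm.
  have tcw : time_change_path (S ^~ w) by split.
  have err := time_changed_error gamma0_neq0 e0 cadX.1 tcw varW t0 Stn L0 fM fL.
  rewrite subr0 normrM (gtr0_norm er) -/B in err *.
  apply: le_trans (ler_wpM2l (ltW er) err) _.
  have rW : e `^ rho * W = eta' by rewrite /W mulrC divfK// gt_eqF.
  have re : e `^ rho * e = e `^ (1 + rho).
    rewrite powRD ?powRr1 ?(ltW e0) 1?mulrC//.
    by rewrite (gt_eqF e0) implybT.
  have Be : B * eta' <= eta / 2.
    by rewrite -eta'E ler_pM2r// lerDl.
  have Me : 3 * M * e `^ (1 + rho) <= eta / 2.
    have s1 : e `^ (1 + rho) <= eta / 2 / (3 * M + 1) by near: e.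
    rewrite ler_pdivlMr in s1; last lra.
    have := powR_ge0 e (1 + rho); lra.
  rewrite mulrDr [_ * (B * W)]mulrCA [_ * (3 * M * e)]mulrCA rW re; lra.
have mBA := measurableU _ _ mB mA; have mNBA := measurableU _ _ mN mBA.
(* The bad event is covered by the irregular paths, the paths whose clock
   passes n before a, and the paths whose variation exceeds W. *)
apply: (@le_trans _ _ (P (N `|` ([set w | n%:R <= S a w] `|` A)))).
  rewrite -[leRHS]measurable_mu_extE; last exact: mNBA.
  apply: le_mu_ext => w /= sup.
  have [Nw|Nw] := pselect (N w); [by left|right].
  have [Sa|Sa] := leP n%:R (S a w); [by left|right].
  apply: contrapT => Aw; move: sup; apply/negP; rewrite -leNgt.
  apply: ge_ereal_sup => _ /= [t + <-]; rewrite in_itv/= => t0a.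
  by rewrite lee_fin good.
apply: le_trans (measureU2 P mN mBA) _.
have PN0 : (P N <= 0)%E by rewrite PN.
rewrite -[leRHS]add0e; apply: leeD => //; apply: le_trans (measureU2 P mB mA) _.
have PA2 : (P A <= (r / 2)%:E)%E.
  apply: le_trans PA _; rewrite lee_fin /W -/C.
  have s2 : e `^ (1 - beta + rho) <= r / 2 / (n%:R * `|C| / eta' + 1) by near: e.
  rewrite (ler_pdivlMr _ _ nC0) in s2.
  have -> : n%:R * (C * e `^ (1 - beta)) / (eta' / e `^ rho) =
      n%:R * C / eta' * e `^ (1 - beta + rho).
    rewrite (@powRD _ e (1 - beta) rho); last by rewrite (gt_eqF e0) implybT.
    by field; rewrite !gt_eqF.
  have q0 := powR_ge0 e (1 - beta + rho).
  have : n%:R * C / eta' * e `^ (1 - beta + rho) <= n%:R * `|C| / eta' * e `^ (1 - beta + rho).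
    rewrite ler_wpM2r// ler_pM2r ?invr_gt0// ler_wpM2l//; exact: ler_norm.
  lra.
have -> : r%:E = ((r / 2)%:E + (r / 2)%:E)%E by rewrite -EFinD; congr EFin; field.
exact: leeD.
Unshelve. all: by end_near. Qed.
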